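(* Let $T$ be a closed normal operator on a complex Hilbert space $H$ and let $A$ be a linear operator on $H$ with $\mathcal D(T)\subseteq\mathcal D(A)$ such that, for some constants $a\ge 0$ and $0\le b<1$, $\|Ax\|^2\le a^2\|x\|^2+b^2\|Tx\|^2$ for all $x\in\mathcal D(T)$. Assume that there exists a subspace $\widetilde H\subseteq\mathcal D(T)$ with $\dim\widetilde H<\infty$ such that $\mathcal D(T)=\widetilde H\oplus\mathcal D_2$ where $\mathcal D_2=\mathcal D(T)\cap\widetilde H^\perp$, and such that $T\widetilde H\subseteq\widetilde H$ and $T\mathcal D_2\subseteq\widetilde H^\perp$, so that $T=T_1\oplus T_2$ with $T_1=T|_{\widetilde H}$ acting in $\widetilde H$ and $T_2=T|_{\mathcal D_2}$ acting in $\widetilde H^\perp$. Let $P_2$ be the orthogonal projection onto $\widetilde H^\perp$ and let $A_{22}=P_2A|_{\mathcal D_2}$, viewed as an operator on $\widetilde H^\perp$. Then $A_{22}$ is $T_2$-bounded with the same constants, i.e. $\|A_{22}x\|^2\le a^2\|x\|^2+b^2\|T_2x\|^2$ for all $x\in\mathcal D_2$, and $$\sigma_{\mathrm{ess}}(T+A)=\sigma_{\mathrm{ess}}(T_2+A_{22}).$$ Moreover, in any open connected subset of $\mathbb C\setminus\sigma_{\mathrm{ess}}(T+A)$ which contains at least one point of the resolvent set of $T+A$, there are at most countably many eigenvalues of $T+A$, and they may accumulate only at the boundary of that subset.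
   Context: $\mathcal D(S)$ denotes the domain of an operator $S$. A closed densely defined operator $T$ on $H$ is normal if $TT^*=T^*T$. The operator $T+A$ has domain $\mathcal D(T)$; $T_2+A_{22}$ has domain $\mathcal D_2$. The resolvent set $\rho(S)$ is the set of $z\in\mathbb C$ such that $S-z$ is bijective from $\mathcal D(S)$ onto the space with bounded inverse. For a closed operator $S$, $\sigma_{\mathrm{ess}}(S)=\{\lambda\in\mathbb C: S-\lambda \text{ is not a Fredholm operator}\}$. *)

(* Defs.v *)
From HB Require Import structures.
From mathcomp Require Import all_boot all_order all_algebra.
From mathcomp Require Import complex.
From mathcomp Require Import all_classical all_reals all_analysis.
Import Order.TTheory GRing.Theory Num.Theory Num.Def.
Import numFieldNormedType.Exports.

Set Implicit Arguments.
Unset Strict Implicit.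
Unset Printing Implicit Defensive.

Local Open Scope ring_scope.
Local Open Scope classical_set_scope.
Local Open Scope complex_scope.

(* A complex Hilbert space is a complete normed module over R[i] with an inner
   product (linear on the left, conjugate-linear on the right) that induces the
   norm. The norm takes its values in R[i], where [x <= y] means that [y - x] is
   a nonnegative real. *)
Definition induces_norm (R : realType) (H : completeNormedModType R[i])
    (dot : {dot H for conjC}) : Prop :=
  forall x : H, dot x x = `|x| ^+ 2.

Definition is_subspace (R : realType) (H : completeNormedModType R[i])
    (V : set H) : Prop :=
  GRing.submod_closed [in V].

Definition finite_dim (R : realType) (H : completeNormedModType R[i])
    (V : set H) : Prop :=
  exists n (e : 'I_n -> H),
    V = [set \sum_(i < n) c i *: e i | c in [set: 'I_n -> R[i]]].

Definition sumset (R : realType) (H : completeNormedModType R[i])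
    (U V : set H) : set H :=
  [set x + y | x in U & y in V].

Definition direct_sum (R : realType) (H : completeNormedModType R[i])
    (W U V : set H) : Prop :=
  W = sumset U V /\ U `&` V = [set 0].

Definition orthocomp (R : realType) (H : completeNormedModType R[i])
    (dot : {dot H for conjC}) (V : set H) : set H :=
  [set x | forall y, V y -> dot x y = 0].

(* When [K] is a closed subspace, there is exactly one such [y]. *)
Definition orthoproj (R : realType) (H : completeNormedModType R[i])
    (dot : {dot H for conjC}) (K : set H) (x : H) : H :=
  xget 0 [set y | K y /\ orthocomp dot K (x - y)].

(* A possibly unbounded operator; the values of [app] outside [dom] are
   irrelevant. *)
Record operator (H : Type) := Operator { dom : set H; app :> H -> H }.

Definition op_eq (H : Type) (S T : operator H) : Prop :=
  dom S = dom T /\ {in dom S, S =1 T}.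

Definition op_comp (H : Type) (S T : operator H) : operator H :=
  Operator [set x | dom T x /\ dom S (T x)] (fun x => S (T x)).

Definition op_restrict (H : Type) (T : operator H) (D : set H) : operator H :=
  Operator D T.

(* [S + B] for [dom S] included in [dom B]. *)
Definition op_add (R : realType) (H : completeNormedModType R[i])
    (S B : operator H) : operator H :=
  Operator (dom S) (fun x => S x + B x).

Definition op_shift (R : realType) (H : completeNormedModType R[i])
    (S : operator H) (z : R[i]) : operator H :=
  Operator (dom S) (fun x => S x - z *: x).

Definition linear_op (R : realType) (H : completeNormedModType R[i])
    (T : operator H) : Prop :=
  is_subspace (dom T) /\
  forall (c : R[i]) (x y : H), dom T x -> dom T y ->
    T (c *: x + y) = c *: T x + T y.

Definition closed_op (R : realType) (H : completeNormedModType R[i])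
    (T : operator H) : Prop :=
  closed [set p : H * H | dom T p.1 /\ p.2 = T p.1].

Definition adjoint_at (R : realType) (H : completeNormedModType R[i])
    (dot : {dot H for conjC}) (T : operator H) (y : H) : set H :=
  [set z | forall x, dom T x -> dot (T x) y = dot x z].

(* For densely defined [T], [adjoint_at dot T y] has at most one element. *)
Definition adjoint (R : realType) (H : completeNormedModType R[i])
    (dot : {dot H for conjC}) (T : operator H) : operator H :=
  Operator [set y | adjoint_at dot T y !=set0]
           (fun y => xget 0 (adjoint_at dot T y)).

Definition normal_op (R : realType) (H : completeNormedModType R[i])
    (dot : {dot H for conjC}) (T : operator H) : Prop :=
  [/\ linear_op T, closed_op T, dense (dom T) &
      op_eq (op_comp T (adjoint dot T)) (op_comp (adjoint dot T) T)].

Definition op_ker (R : realType) (H : completeNormedModType R[i])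
    (T : operator H) : set H :=
  [set x | dom T x /\ T x = 0].

Definition op_range (H : Type) (T : operator H) : set H := T @` dom T.

(* Below, [K] is the Hilbert space in which [T] acts: [setT], or a closed
   subspace of [H] that contains the domain and the range of [T]. Since [K] is
   closed, closedness in [K] is closedness in [H]. *)

Definition finite_codim (R : realType) (H : completeNormedModType R[i])
    (K V : set H) : Prop :=
  exists2 N : set H, finite_dim N & K = sumset V N.

Definition fredholm (R : realType) (H : completeNormedModType R[i])
    (K : set H) (T : operator H) : Prop :=
  [/\ closed_op T, finite_dim (op_ker T), closed (op_range T) &
      finite_codim K (op_range T)].

(* [R[i]^o] is [R[i]] with the topology of the modulus. *)
Definition ess_spectrum (R : realType) (H : completeNormedModType R[i])
    (K : set H) (T : operator H) : set R[i]^o :=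
  [set z | ~ fredholm K (op_shift T z)].

Definition resolvent_set (R : realType) (H : completeNormedModType R[i])
    (K : set H) (T : operator H) : set R[i]^o :=
  [set z | set_bij (dom T) K (op_shift T z) /\
     exists M : R, forall x, dom T x -> `|x| <= M%:C * `|op_shift T z x|].

Definition eigenvalues (R : realType) (H : completeNormedModType R[i])
    (T : operator H) : set R[i]^o :=
  [set z | exists x : H, [/\ dom T x, x != 0 & T x = z *: x]].

Definition boundary (X : topologicalType) (E : set X) : set X :=
  closure E `\` E°.

(* Main.v *)
Require Import Defs.
From HB Require Import structures.
From mathcomp Require Import all_boot all_order all_algebra.
From mathcomp Require Import complex.
From mathcomp Require Import all_classical all_reals all_analysis.
From mathcomp Require Import zify ring lra.
Import Order.TTheory GRing.Theory Num.Theory Num.Def.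
Import numFieldNormedType.Exports.

Set Implicit Arguments.
Unset Strict Implicit.
Unset Printing Implicit Defensive.

Local Open Scope ring_scope.
Local Open Scope classical_set_scope.
Local Open Scope complex_scope.

(** Neither the domain splitting nor the compression to the orthogonal complement
of [Ht] changes more than finitely many dimensions, and Fredholmness does not
see finitely many dimensions.

Write [S] for [T + A - z], [K] for the orthogonal complement of [Ht], and [P]
for the projection onto [K], so that [T2 + A22 - z] is the compression
[P S] of [S] to [D2]. Both operators are closed, because a perturbation of
relative bound less than 1 preserves closedness
([closed_on_relatively_bounded]); the relative bound passes to the compression
because [P] is a contraction. Kernels and codimensions of ranges of [S] and of
[P S] are compared by linear algebra: they differ by images and preimages of
finite-dimensional spaces ([finite_dim_ker_compression],
[finite_codim_compression]). Closedness of the ranges is then automatic: a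
closed operator whose range has a finite-dimensional complement has closed range
([closed_range_finite_codim]), which is the open mapping theorem applied to
the map [(x, n) |-> S x + n] ([bounded_preimages]).

For the eigenvalues the central fact is that around a point [c] where
[L - c] is Fredholm, either every nearby point other than [c] is an eigenvalue
of [L], or none is ([punctured_neighbourhood]). To see it, let [S = L - c] and
let [M] be the intersection of the iterated ranges of [S]. Eigenvectors of [S] for
nonzero eigenvalues lie in [M]; the space [M] is closed; and [S] maps [M] onto
[M] since the kernel of [S] is finite-dimensional. If [S] is injective on [M], it is
bounded below there, hence has no small nonzero eigenvalue. If [S] kills some
nonzero [x0] in [M], then choosing [S x_(k+1) = x_k] in [M] with geometric bounds,
the series of the [mu^k x_k] is an eigenvector for every small [mu].

The two alternatives define disjoint open sets covering the connected set [Om]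
([connected_dichotomy]), and a point of the resolvent set satisfies the
second one. So every point of [Om] has a punctured neighbourhood without
eigenvalues, which gives countability and the absence of accumulation points
inside [Om]. *)

(** * Real-valued norms and sequences *)

Section ComplexOfReal.
Variable R : realType.
Implicit Types r s : R.

Lemma realcD r s : (r + s)%:C = r%:C + s%:C.
Proof. exact: rmorphD. Qed.

Lemma realcM r s : (r * s)%:C = r%:C * s%:C.
Proof. exact: rmorphM. Qed.

Lemma realcV r : (r^-1)%:C = (r%:C)^-1.
Proof. exact: fmorphV. Qed.

End ComplexOfReal.

Section RealNorm.
Variables (R : realType) (V : normedZmodType R[i]).
Implicit Types x y : V.

(** The norm of a complex normed space takes its values in [R[i]], whose order is
partial; this real-valued copy gives access to linear arithmetic. *)
Definition rnorm x : R := complex.Re `|x|.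

Lemma rnormE x : `|x| = (rnorm x)%:C.
Proof. by rewrite /rnorm RRe_real// normr_real. Qed.

Lemma rnorm_ge0 x : 0 <= rnorm x.
Proof. by rewrite -ler0c -rnormE. Qed.

Lemma rnorm0 : rnorm (0 : V) = 0.
Proof. by rewrite /rnorm normr0. Qed.

Lemma rnorm_eq0 x : (rnorm x == 0) = (x == 0).
Proof. by rewrite -[RHS]normr_eq0 rnormE -(inj_eq (@complexI R)). Qed.

Lemma rnorm_gt0 x : (0 < rnorm x) = (x != 0).
Proof. by rewrite lt0r rnorm_ge0 andbT rnorm_eq0. Qed.

Lemma ler_rnormD x y : rnorm (x + y) <= rnorm x + rnorm y.
Proof. by rewrite -lecR realcD -!rnormE ler_normD. Qed.

Lemma rnormN x : rnorm (- x) = rnorm x.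
Proof. by rewrite /rnorm normrN. Qed.

Lemma rnormB x y : rnorm (x - y) = rnorm (y - x).
Proof. by rewrite -rnormN opprB. Qed.

Lemma ler_rnormB x y : rnorm (x - y) <= rnorm x + rnorm y.
Proof. by rewrite -(rnormN y) ler_rnormD. Qed.

Lemma rnorm_le0_eq0 x : rnorm x <= 0 -> x = 0.
Proof.
move=> x0; apply/eqP; rewrite -rnorm_eq0.
by apply/eqP/le_anti; rewrite x0 rnorm_ge0.
Qed.

End RealNorm.

Lemma rnormZ (R : realType) (V : normedModType R[i]) (c : R[i]) (x : V) :
  rnorm (c *: x) = rnorm c * rnorm x.
Proof.
by apply: (@complexI R); rewrite realcM -!rnormE normrZ.
Qed.

Lemma rnormM (R : realType) (c d : R[i]) : rnorm (c * d) = rnorm c * rnorm d.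
Proof.
by apply: (@complexI R); rewrite realcM -!rnormE normrM.
Qed.

Lemma rnormV (R : realType) (c : R[i]) : rnorm c^-1 = (rnorm c)^-1.
Proof.
by apply: (@complexI R); rewrite realcV -!rnormE normfV.
Qed.

Lemma rnormC (R : realType) (r : R) : rnorm r%:C = `|r|.
Proof.
by apply: (@complexI R); rewrite -rnormE normc_def /= expr0n addr0 sqrtr_sqr.
Qed.

Section Sequences.
Variables (R : realType) (V : normedModType R[i]).
Implicit Types (u v : nat -> V) (l m : V).

Lemma cvg_rnormP u l :
  u @ \oo --> l <->
  forall e : R, 0 < e -> exists N, forall n, (N <= n)%N -> rnorm (u n - l) < e.
Proof.
split=> [ul e e0|ul].
  have e0' : 0 < e%:C by rewrite ltcR.
  have /cvgrPdist_lt/(_ _ e0')[N _ HN] := ul.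
  by exists N => n /HN /=; rewrite rnormE ltcR rnormB.
apply/cvgrPdist_lt => e e0.
have eE : e = (complex.Re e)%:C by rewrite RRe_real// gtr0_real.
have /ul[N HN] : 0 < complex.Re e by rewrite -ltcR -eE.
by exists N => // n /HN /=; rewrite [in X in _ -> X]eE rnormE ltcR rnormB.
Qed.

Lemma rnorm_lim_le u l (M : R) :
  (forall n, rnorm (u n) <= M) -> u @ \oo --> l -> rnorm l <= M.
Proof.
move=> H /cvg_rnormP ul; apply/ler_addgt0Pr => e /ul[N /(_ N (leqnn N))] lt.
have := ler_rnormB (u N) (u N - l); rewrite subKr; have := H N.
lra.
Qed.

Lemma nbhs_rnormP l (A : set V) :
  nbhs l A <-> exists2 r : R, 0 < r & forall x, rnorm (x - l) < r -> A x.
Proof.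
split=> [/nbhs_ballP[r /= r0 rA]|[r r0 rA]].
  have rE : r = (complex.Re r)%:C by rewrite RRe_real// gtr0_real.
  exists (complex.Re r) => [|x xl]; first by rewrite -ltcR -rE.
  by apply: rA; rewrite -ball_normE/= rE rnormE ltcR rnormB.
apply/nbhs_ballP; exists r%:C => /=; first by rewrite ltcR.
by move=> x; rewrite -ball_normE/= rnormE ltcR rnormB; exact: rA.
Qed.

(** All closedness arguments below extract limits of sequences, so closedness is
used in this form, both for subspaces and for graphs in [H * H]. *)
Lemma closed_seqP (A : set V) :
  closed A <->
  forall u l, (forall n, A (u n)) -> u @ \oo --> l -> A l.
Proof.
split=> [cA u l Au ul|H l cl].
  by apply: (closed_cvg _ cA) ul; apply: nearW.
have B (n : nat) : exists x, A x /\ rnorm (x - l) < n.+1%:R^-1.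
  have [|x []] := cl [set x | rnorm (x - l) < n.+1%:R^-1]; last by exists x.
  by apply/nbhs_rnormP; exists n.+1%:R^-1; rewrite ?invr_gt0.
have [u Hu] := choice B.
apply: (H u) => [n|]; first exact: (Hu n).1.
apply/cvg_rnormP => e e0; exists (truncn e^-1) => n Nn.
apply: lt_le_trans (Hu n).2 _; rewrite -[leRHS]invrK lef_pV2 ?posrE ?invr_gt0//.
apply: ltW; apply: lt_le_trans (truncnS_gt _) _.
by rewrite ler_nat ltnS.
Qed.

Lemma cvg_inj u l m : u @ \oo --> l -> u @ \oo --> m -> l = m.
Proof. by move=> ul um; apply: (cvg_unique _ ul um). Qed.

End Sequences.

Lemma cvg_rnorm_le (R : realType) (V W : normedModType R[i])
    (u : nat -> V) (l : V) (w : nat -> W) (k : W) (C : R) :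
  (forall n, rnorm (u n - l) <= C * rnorm (w n - k)) ->
  w @ \oo --> k -> u @ \oo --> l.
Proof.
move=> H /cvg_rnormP wk; apply/cvg_rnormP => e e0.
have C0 : 0 < 1 + `|C| by rewrite ltr_wpDr.
have [|N HN] := wk (e / (1 + `|C|)); first by rewrite divr_gt0.
exists N => n /HN; rewrite ltr_pdivlMr// => lt; apply: le_lt_trans lt.
apply: (le_trans (H n)); rewrite mulrC ler_wpM2l ?rnorm_ge0//.
by have := ler_norm C; lra.
Qed.

Section Completeness.
Variables (R : realType) (H : completeNormedModType R[i]).

Lemma rnorm_cauchy_cvg (u : nat -> H) :
  (forall e : R, 0 < e -> exists N, forall n, (N <= n)%N -> rnorm (u n - u N) < e) ->
  exists l : H, u @ \oo --> l.
Proof.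
move=> cu; have : cauchy (u @ \oo); last first.
  by move=> /cauchy_cvgP ul; exists (lim (u @ \oo)).
apply: cauchy_exP => e e0.
have eE : e = (complex.Re e)%:C by rewrite RRe_real// gtr0_real.
have /cu[N HN] : 0 < complex.Re e by rewrite -ltcR -eE.
exists (u N), N => // n /HN.
by rewrite -ball_normE/= => lt; rewrite eE rnormE ltcR rnormB.
Qed.

Lemma half_powS (n : nat) : (2^-1 : R) ^+ n.+1 = 2^-1 ^+ n / 2.
Proof. by rewrite exprSr. Qed.

Lemma half_pow_small (c e : R) : 0 < e -> exists N, c * 2^-1 ^+ N < e.
Proof.
move=> e0; have := @cvg_geometric R c 2^-1.
rewrite ger0_norm ?invr_ge0// invf_lt1 ?ltr1n// => /(_ isT).
move=> /cvgrPdist_lt/(_ _ e0)[N _ /(_ N (leqnn N))]/=.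
by rewrite sub0r normrN => /(le_lt_trans (ler_norm _)) lt; exists N.
Qed.

(** The only completeness argument for series: it produces the preimages of the
open mapping theorem and the eigenvectors of [eigenvector_series]. *)
Lemma geometric_series_cvg (z : nat -> H) (c : R) :
  (forall k, rnorm (z k) <= c * 2^-1 ^+ k) ->
  exists s : H, (fun n => \sum_(k < n) z k) @ \oo --> s /\ rnorm s <= 2 * c.
Proof.
move=> Hz; pose u n := \sum_(k < n) z k.
have tail n m : rnorm (u (n + m)%N - u n) <= 2 * c * (2^-1 ^+ n - 2^-1 ^+ (n + m)).
  elim: m => [|m IH]; first by rewrite addn0 !subrr rnorm0 mulr0.
  rewrite addnS /u big_ord_recr/= addrAC half_powS.
  have := ler_rnormD (u (n + m)%N - u n) (z (n + m)%N); have := Hz (n + m)%N.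
  rewrite /u in IH *; lra.
have c0 : 0 <= c by have := Hz 0%N; rewrite expr0 mulr1; have := rnorm_ge0 (z 0%N); lra.
have tail' n m : (n <= m)%N -> rnorm (u m - u n) <= 2 * c * 2^-1 ^+ n.
  move=> /subnKC <-; apply: le_trans (tail _ _) _; apply: ler_wpM2l; first lra.
  by rewrite gerBl exprn_ge0// invr_ge0.
have [s us] : exists s : H, u @ \oo --> s.
  apply: rnorm_cauchy_cvg => e /(half_pow_small (2 * c))[N HN].
  by exists N => n /tail' le; apply: le_lt_trans le HN.
exists s; split => //; apply: (rnorm_lim_le _ us) => n.
by have := tail' 0%N n isT; rewrite /u big_ord0 subr0 expr0 mulr1.
Qed.

End Completeness.

Section ComplexSequences.
Variable R : realType.

Lemma rnorm_ge_Re (z : R[i]) : `|complex.Re z| <= rnorm z.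
Proof. by rewrite -lecR -rnormE normc_ge_Re. Qed.

Lemma rnorm_ge_Im (z : R[i]) : `|complex.Im z| <= rnorm z.
Proof.
have := rnorm_ge_Re (z * - 'i%C); rewrite rnormM rnormN mulrN.
have -> : complex.Re (- (z * 'i%C)) = complex.Im z by case: z => u v /=; ring.
by rewrite /(rnorm 'i%C) normc_def /= expr0n expr1n add0r sqrtr1 mulr1.
Qed.

Lemma rnorm_le_ReIm (z : R[i]) : rnorm z <= `|complex.Re z| + `|complex.Im z|.
Proof.
rewrite {1}[z]complexE (le_trans (ler_rnormD _ _))// rnormM !rnormC.
by rewrite /(rnorm 'i%C) normc_def /= expr0n expr1n add0r sqrtr1 mul1r.
Qed.

Lemma real_cauchy_cvg (u : nat -> R) :
  (forall e : R, 0 < e -> exists N, forall n, (N <= n)%N -> `|u n - u N| < e) ->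
  exists l : R, forall e : R, 0 < e ->
    exists N, forall n, (N <= n)%N -> `|u n - l| < e.
Proof.
move=> cu; have : cauchy (u @ \oo).
  apply: cauchy_exP => e /cu[N HN]; exists (u N), N => // n /HN.
  by rewrite -ball_normE/= distrC.
move=> /R_complete/cvgrPdist_lt ul; exists (lim (u @ \oo)) => e /ul[N _ HN].
by exists N => n /HN /=; rewrite distrC.
Qed.

(** Needed for the coefficients along a line in [closed_add_line]. *)
Lemma complex_cauchy_cvg (c : nat -> R[i]^o) :
  (forall e : R, 0 < e -> exists N, forall n, (N <= n)%N -> rnorm (c n - c N) < e) ->
  exists d : R[i]^o, c @ \oo --> d.
Proof.
move=> cc; have [|a Ha] := @real_cauchy_cvg (fun n => complex.Re (c n)).
  move=> e /cc[N HN]; exists N => n /HN; apply: le_lt_trans.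
  by rewrite -raddfB; exact: rnorm_ge_Re.
have [|b Hb] := @real_cauchy_cvg (fun n => complex.Im (c n)).
  move=> e /cc[N HN]; exists N => n /HN; apply: le_lt_trans.
  by rewrite -raddfB; exact: rnorm_ge_Im.
exists (a +i* b)%C; apply/cvg_rnormP => e e0.
have [|N HN] := Ha (e / 2); first by rewrite divr_gt0.
have [|M HM] := Hb (e / 2); first by rewrite divr_gt0.
exists (maxn N M) => n; rewrite geq_max => /andP[/HN ltN /HM ltM].
have := rnorm_le_ReIm (c n - (a +i* b)%C).
have -> : complex.Re (c n - (a +i* b)%C) = complex.Re (c n) - a by case: (c n).
have -> : complex.Im (c n - (a +i* b)%C) = complex.Im (c n) - b by case: (c n).
lra.
Qed.

End ComplexSequences.

(** * Subspaces and finite dimension *)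

Section Subspaces.
Variables (R : realType) (H : completeNormedModType R[i]).
Implicit Types (U V W F D : set H) (f : H -> H) (x y e : H).

Lemma subspaceP V :
  is_subspace V <->
  V 0 /\ forall (c : R[i]) x y, V x -> V y -> V (c *: x + y).
Proof.
split=> [[V0 HV]|[V0 HV]]; split.
- by move: V0; rewrite inE.
- by move=> c x y Vx Vy; have := HV c x y; rewrite !inE; apply.
- by rewrite inE.
- by move=> c x y; rewrite !inE; apply: HV.
Qed.

Section Closure.
Variables (V : set H) (sV : is_subspace V).

Lemma subspace0 : V 0.
Proof. by have /subspaceP[] := sV. Qed.

Lemma subspaceDZ c x y : V x -> V y -> V (c *: x + y).
Proof. by have /subspaceP[_] := sV; apply. Qed.

Lemma subspaceD x y : V x -> V y -> V (x + y).
Proof. by rewrite -{2}(scale1r x); apply: subspaceDZ. Qed.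

Lemma subspaceZ c x : V x -> V (c *: x).
Proof. by move=> Vx; rewrite -(addr0 (c *: x)); apply: subspaceDZ => //; exact: subspace0. Qed.

Lemma subspaceN x : V x -> V (- x).
Proof. by rewrite -scaleN1r; apply: subspaceZ. Qed.

Lemma subspaceB x y : V x -> V y -> V (x - y).
Proof. by move=> Vx Vy; apply: subspaceD => //; apply: subspaceN. Qed.

Lemma subspace_sum n (z : nat -> H) :
  (forall k, V (z k)) -> V (\sum_(k < n) z k).
Proof.
move=> Vz; elim: n => [|n IH]; first by rewrite big_ord0; apply: subspace0.
by rewrite big_ord_recr/=; apply: subspaceD.
Qed.

End Closure.

Lemma subspaceI U V : is_subspace U -> is_subspace V -> is_subspace (U `&` V).
Proof.
move=> sU sV; apply/subspaceP; split; first by split; apply: subspace0.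
by move=> c x y [Ux Vx] [Uy Vy]; split; apply: subspaceDZ.
Qed.

Lemma subspace_set0 : is_subspace ([set 0] : set H).
Proof. by apply/subspaceP; split => // c x y -> ->; rewrite scaler0 addr0. Qed.

Lemma subspace_setT : is_subspace (setT : set H).
Proof. exact/subspaceP. Qed.

Lemma subspace_sumset U V :
  is_subspace U -> is_subspace V -> is_subspace (sumset U V).
Proof.
move=> sU sV; apply/subspaceP; split.
  by exists 0; [exact: subspace0|exists 0; [exact: subspace0|rewrite addr0]].
move=> c _ _ [u Uu [v Vv <-]] [u' Uu' [v' Vv' <-]].
exists (c *: u + u'); first exact: subspaceDZ.
by exists (c *: v + v'); [exact: subspaceDZ|rewrite scalerDr addrACA].
Qed.

(** Linearity is relative to a subspace, as the values of an operator outside its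
domain are arbitrary. *)
Definition linear_on D f :=
  forall (c : R[i]) x y, D x -> D y -> f (c *: x + y) = c *: f x + f y.

Section LinearOn.
Variables (D : set H) (f : H -> H) (sD : is_subspace D) (lf : linear_on D f).

Lemma linear_on0 : f 0 = 0.
Proof.
have D0 := subspace0 sD.
apply: (addIr (f 0)); rewrite add0r -{1}(scale1r (f 0)) -(lf 1 D0 D0).
by rewrite scaler0 addr0.
Qed.

Lemma linear_onD x y : D x -> D y -> f (x + y) = f x + f y.
Proof. by move=> Dx Dy; rewrite -{1}(scale1r x) lf// scale1r. Qed.

Lemma linear_onZ c x : D x -> f (c *: x) = c *: f x.
Proof. by move=> Dx; rewrite -{1}(addr0 (c *: x)) lf ?linear_on0 ?addr0//; exact: subspace0. Qed.

Lemma linear_onB x y : D x -> D y -> f (x - y) = f x - f y.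
Proof. by move=> Dx Dy; rewrite -(scaleN1r y) addrC lf// scaleN1r addrC. Qed.

Lemma linear_on_sum n (z : nat -> H) :
  (forall k, D (z k)) -> f (\sum_(k < n) z k) = \sum_(k < n) f (z k).
Proof.
move=> Dz; elim: n => [|n IH]; first by rewrite !big_ord0 linear_on0.
rewrite !big_ord_recr/= -IH; apply: linear_onD => //.
exact: (subspace_sum sD).
Qed.

Lemma subspace_image : is_subspace (f @` D).
Proof.
apply/subspaceP; split; first by exists 0; [exact: subspace0|exact: linear_on0].
move=> c _ _ [x Dx <-] [y Dy <-].
by exists (c *: x + y); [exact: subspaceDZ|exact: lf].
Qed.

Lemma subspace_preimage V : is_subspace V -> is_subspace [set x | D x /\ V (f x)].
Proof.
move=> sV; apply/subspaceP; split.
  by split; [exact: subspace0|rewrite linear_on0; exact: subspace0].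
move=> c x y [Dx Vx] [Dy Vy]; split; first exact: subspaceDZ.
by rewrite lf//; apply: subspaceDZ.
Qed.

End LinearOn.

Lemma linear_onW U D f : U `<=` D -> linear_on D f -> linear_on U f.
Proof. by move=> sUD lf c x y Ux Uy; apply: lf; apply: sUD. Qed.

(** Finite-dimensional spaces are handled one vector at a time through this
operation and the induction principle [finite_dim_ind]; no dimension is ever
counted. *)
Definition add_line V e : set H := [set x | exists v c, V v /\ x = v + c *: e].

Lemma sub_add_line V e : V `<=` add_line V e.
Proof. by move=> v Vv; exists v, 0; rewrite scale0r addr0. Qed.

Lemma mem_add_line V e : is_subspace V -> add_line V e e.
Proof. by move=> sV; exists 0, 1; rewrite add0r scale1r; split=> //; exact: subspace0. Qed.

Lemma subspace_add_line V e : is_subspace V -> is_subspace (add_line V e).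
Proof.
move=> sV; apply/subspaceP; split; first by apply/sub_add_line/(subspace0 sV).
move=> c _ _ [v [d [Vv ->]]] [w [d' [Vw ->]]].
exists (c *: v + w), (c * d + d'); split; first exact: subspaceDZ.
by rewrite scalerDr scalerA scalerDl addrACA.
Qed.

Lemma add_line_sub U V e :
  is_subspace U -> V `<=` U -> U e -> add_line V e `<=` U.
Proof.
move=> sU VU Ue _ [v [c [Vv ->]]].
by apply: subspaceD => //; [exact: VU|exact: subspaceZ].
Qed.

Lemma add_line_id V e : is_subspace V -> V e -> add_line V e = V.
Proof. by move=> sV Ve; apply/seteqP; split; [exact: add_line_sub|exact: sub_add_line]. Qed.

(** The coefficient of [e ord0] is split off the sum, so that a span of [n.+1]
vectors is a span of [n] vectors enlarged by a line. *)
Lemma span_recl n (e : 'I_n.+1 -> H) :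
  [set \sum_(i < n.+1) c i *: e i | c in [set: 'I_n.+1 -> R[i]]] =
  add_line [set \sum_(i < n) c i *: e (lift ord0 i) | c in [set: 'I_n -> R[i]]]
    (e ord0).
Proof.
apply/seteqP; split=> [_ [c _ <-]|_ [_ [d [[c _ <-] ->]]]].
  exists (\sum_(i < n) c (lift ord0 i) *: e (lift ord0 i)), (c ord0).
  by split; [exists (fun i => c (lift ord0 i))|rewrite big_ord_recl addrC].
exists (fun i => oapp c d (unlift ord0 i)) => //.
rewrite big_ord_recl unlift_none addrC/=; congr (_ + _).
by apply: eq_bigr => i _; rewrite liftK.
Qed.

Lemma span_nil (e : 'I_0 -> H) :
  [set \sum_(i < 0) c i *: e i | c in [set: 'I_0 -> R[i]]] = [set 0].
Proof.
apply/seteqP; split=> [_ [c _ <-]|_ ->]; first by rewrite big_ord0.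
by exists (fun=> 0); rewrite ?big_ord0.
Qed.

Lemma finite_dim0 : finite_dim ([set 0] : set H).
Proof. by exists 0%N, (fun=> 0); rewrite span_nil. Qed.

Lemma finite_dim_add_line V e : finite_dim V -> finite_dim (add_line V e).
Proof.
move=> [n [v ->]]; exists n.+1, (fun i => oapp v e (unlift ord0 i)).
rewrite span_recl unlift_none/=; congr add_line.
by congr image; apply/funext => c; apply: eq_bigr => i _; rewrite liftK.
Qed.

Lemma finite_dim_ind (P : set H -> Prop) :
  P [set 0] ->
  (forall V e, finite_dim V -> P V -> P (add_line V e)) ->
  forall V, finite_dim V -> P V.
Proof.
move=> P0 PS _ [n [e ->]]; elim: n e => [|n IH] e; first by rewrite span_nil.
by rewrite span_recl; apply: PS => //; exists n, (fun i => e (lift ord0 i)).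
Qed.

Lemma finite_dim_subspace V : finite_dim V -> is_subspace V.
Proof.
elim/finite_dim_ind => [|{}V e _ sV]; first exact: subspace_set0.
exact: subspace_add_line.
Qed.

Lemma sumset0 U : sumset U [set 0] = U.
Proof.
apply/seteqP; split=> [_ [u Uu [_ -> <-]]|u Uu]; first by rewrite addr0.
by exists u => //; exists 0; rewrite ?addr0.
Qed.

Lemma sumset_add_line U V e :
  sumset U (add_line V e) = add_line (sumset U V) e.
Proof.
apply/seteqP; split=> [_ [u Uu [_ [v [c [Vv ->]]] <-]]|].
  by exists (u + v), c; rewrite addrA; split => //; exists u => //; exists v.
move=> _ [_ [c [[u Uu [v Vv <-]] ->]]]; exists u => //.
by exists (v + c *: e); rewrite ?addrA//; exists v, c.
Qed.

Lemma finite_dim_sumset U V :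
  finite_dim U -> finite_dim V -> finite_dim (sumset U V).
Proof.
move=> fU; elim/finite_dim_ind => [|{}V e _ fUV].
  by rewrite sumset0.
by rewrite sumset_add_line; exact: finite_dim_add_line.
Qed.

Lemma finite_dim_image D f V :
  is_subspace D -> linear_on D f -> V `<=` D ->
  finite_dim V -> finite_dim (f @` V).
Proof.
move=> sD lf + fV; elim/finite_dim_ind: V / fV => [_|V e fV IH VD].
  rewrite image_set1 (linear_on0 sD lf); exact: finite_dim0.
have sV := finite_dim_subspace fV.
have VD' : V `<=` D := subset_trans (@sub_add_line V e) VD.
have De : D e := VD _ (mem_add_line e sV).
suff -> : f @` add_line V e = add_line (f @` V) (f e).
  by apply/finite_dim_add_line/IH.
apply/seteqP; split=> [_ [_ [v [c [Vv ->]]] <-]|_ [_ [c [[v Vv <-] ->]]]].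
  exists (f v), c; split; first by exists v.
  by rewrite addrC lf ?(addrC (f v))//; exact: VD'.
exists (v + c *: e); first by exists v, c.
by rewrite addrC lf ?(addrC (f v))//; exact: VD'.
Qed.

(** Rank-nullity without dimensions. When the image is enlarged by a line, the
preimage of the smaller image is either everything or misses some [u], and
subtracting the right multiple of [u] moves any other vector into it. *)
Lemma finite_dim_ker_image F U f :
  finite_dim F -> is_subspace U -> linear_on U f -> f @` U `<=` F ->
  finite_dim (U `&` [set x | f x = 0]) -> finite_dim U.
Proof.
move=> fF; elim/finite_dim_ind: F / fF U => [|F e fF IH] U sU lf fUF fK.
  by rewrite -(setIidl (_ : U `<=` [set x | f x = 0])) // => x Ux; apply: fUF; exists x.
have sF := finite_dim_subspace fF.
pose U' := [set x | U x /\ F (f x)].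
have sU' : is_subspace U' by exact: subspace_preimage.
have fU' : finite_dim U'.
  apply: IH => //; first by apply: (linear_onW _ lf) => x [].
    by move=> _ [x [_ Fx] <-].
  suff -> : U' `&` [set x | f x = 0] = U `&` [set x | f x = 0] by [].
  apply/seteqP; split=> [x [[Ux _] fx]|x [Ux fx]]//.
  by split=> //; split=> //; rewrite fx; exact: subspace0.
have [UU'|/existsNP[u /not_implyP[Uu nU'u]]] := pselect (U `<=` U').
  by suff -> : U = U' by []; apply/seteqP; split=> // x [].
have [v [c [Fv fuE]]] : add_line F e (f u) by apply: fUF; exists u.
have c0 : c != 0.
  apply/eqP => c0; apply: nU'u; split=> //.
  by rewrite fuE c0 scale0r addr0.
suff -> : U = add_line U' u by exact: finite_dim_add_line.
apply/seteqP; split; last by apply: add_line_sub => // x [].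
move=> x Ux; have [w [d [Fw fxE]]] : add_line F e (f x) by apply: fUF; exists x.
exists (x - (d / c) *: u), (d / c); split; last by rewrite subrK.
have Ucu := subspaceZ sU (d / c) Uu.
split; first exact: subspaceB.
rewrite (linear_onB lf)// (linear_onZ sU lf)// fxE fuE scalerDr scalerA.
rewrite divfK// opprD addrACA subrr addr0.
by apply: subspaceB => //; exact: subspaceZ.
Qed.

(** Apply the previous lemma to the identity map, whose kernel is trivial. *)
Lemma finite_dimS U V :
  is_subspace U -> U `<=` V -> finite_dim V -> finite_dim U.
Proof.
move=> sU UV fV; apply: (@finite_dim_ker_image V U id) => //.
  by rewrite image_id.
suff -> : U `&` [set x | x = 0] = [set 0] by exact: finite_dim0.
by apply/seteqP; split=> [x []|x ->]//; split => //; exact: subspace0.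
Qed.

(** Lines contained in the sum built so far are skipped, so that the sum stays
direct. *)
Lemma finite_dim_complement V F :
  is_subspace V -> finite_dim F ->
  exists F', [/\ finite_dim F', sumset V F' = sumset V F & V `&` F' = [set 0]].
Proof.
move=> sV; elim/finite_dim_ind => [|{}F e fF [F' [fF' VF VF'0]]].
  exists [set 0]; split => //; first exact: finite_dim0.
  by apply/seteqP; split=> [x []|x ->]//; split=> //; exact: subspace0.
have sF' := finite_dim_subspace fF'.
have sVF' := subspace_sumset sV sF'.
have [VF'e|nVF'e] := pselect (sumset V F' e).
  by exists F'; split => //; rewrite sumset_add_line -VF add_line_id.
exists (add_line F' e); split; [exact: finite_dim_add_line|by rewrite !sumset_add_line VF|].
apply/seteqP; split=> [x [Vx [v [c [F'v xE]]]]|x ->]; last first.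
  by split; [exact: subspace0|exact/sub_add_line/(subspace0 sF')].
have [c0|c0] := eqVneq c 0.
  by rewrite -VF'0; split=> //; rewrite xE c0 scale0r addr0.
case: nVF'e; exists (c^-1 *: x); first exact: subspaceZ.
exists (- (c^-1 *: v)); first exact/(subspaceN sF')/(subspaceZ sF').
by rewrite xE scalerDr scalerA mulVf// scale1r addrAC subrr add0r.
Qed.

(** Induction on [F]. Either some [W m] already lies in the smaller space, or all of
them contain a vector outside it; in the second case the traces on the smaller
space determine the [W n], since the component along the new line can be removed
with a vector of the smaller [W n]. *)
Lemma decreasing_finite_dim_stable F (W : nat -> set H) :
  finite_dim F -> (forall n, is_subspace (W n)) -> (forall n, W n `<=` F) ->
  (forall n, W n.+1 `<=` W n) ->
  exists N, forall n, (N <= n)%N -> W n = W N.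
Proof.
move=> fF; elim/finite_dim_ind: F / fF W => [|F e fF IH] W sW WF dW.
  exists 0%N => n _; apply/seteqP; split=> x /WF ->; exact: (subspace0 (sW _)).
have sF := finite_dim_subspace fF.
have dWle m n : (m <= n)%N -> W n `<=` W m.
  by move=> /subnKC <-; elim: (n - m)%N => [|k IHk]; rewrite ?addn0// addnS => x /dW/IHk.
have [[m Wm]|nW] := pselect (exists m, W m `<=` F).
  have [n|n|n|N HN] := IH (fun n => W (n + m)%N).
  - exact: sW.
  - by apply: subset_trans Wm; apply: dWle; rewrite leq_addl.
  - exact: dW.
  exists (N + m)%N => n Nmn; rewrite -(HN (n - m)%N); last lia.
  by rewrite subnK//; lia.
have [n|n|n|N HN] := IH (fun n => W n `&` F).
- exact: subspaceI.
- by move=> x [].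
- by move=> x [/dW Wx Fx].
exists N => n Nn; apply/seteqP; split=> [|x WNx]; first exact: dWle.
have /existsNP[w /not_implyP[Wnw nFw]] : ~ W n `<=` F by move=> WnF; apply: nW; exists n.
have [v [c [Fv xE]]] := WF _ _ WNx; have [v' [c' [Fv' wE]]] := WF _ _ Wnw.
have c'0 : c' != 0 by apply/eqP => c'0; apply: nFw; rewrite wE c'0 scale0r addr0.
have Wcw := subspaceZ (sW n) (c / c') Wnw.
suff : (W n `&` F) (x - (c / c') *: w).
  by move=> [Wxw _]; rewrite -(subrK ((c / c') *: w) x); apply: subspaceD.
rewrite (HN _ Nn); split; first by apply: subspaceB => //; apply: dWle Wcw.
rewrite xE wE scalerDr scalerA divfK// opprD addrACA subrr addr0.
by apply: subspaceB => //; exact: subspaceZ.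
Qed.

End Subspaces.

(** * Closed subspaces and the open mapping theorem *)

Section ClosedSubspaces.
Variables (R : realType) (H : completeNormedModType R[i]).
Implicit Types (K N V F D : set H) (S : H -> H) (x y e : H).

Lemma scalar_cvg (c : nat -> R[i]^o) (d : R[i]^o) e :
  c @ \oo --> d -> (fun n => c n *: e) @ \oo --> d *: e.
Proof.
apply: (@cvg_rnorm_le _ _ _ _ _ _ _ (rnorm e)) => n.
by rewrite -scalerBl rnormZ mulrC.
Qed.

(** If [e] lies outside [V], it has positive distance [d] to [V], so the norm of
[v + c *: e] is at least [d] times the modulus of [c]: along a convergent sequence
of such sums the coefficients are Cauchy. *)
Lemma closed_add_line V e :
  is_subspace V -> closed V -> closed (add_line V e).
Proof.
move=> sV cV; have [Ve|nVe] := pselect (V e); first by rewrite add_line_id.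
have [d d0 dV] : exists2 d : R, 0 < d & forall v, V v -> d <= rnorm (v - e).
  apply: contrapT => nd; apply: nVe; apply: cV => B /nbhs_rnormP[r r0 rB].
  apply: contrapT => nVB; apply: nd; exists r => // v Vv.
  by rewrite leNgt; apply/negP => vr; apply: nVB; exists v; split => //; exact: rB.
have dist v (c : R[i]) : V v -> d * rnorm c <= rnorm (v + c *: e).
  move=> Vv; have [->|c0] := eqVneq c 0; first by rewrite rnorm0 mulr0 rnorm_ge0.
  have -> : v + c *: e = - c *: (- (c^-1 *: v) - e).
    by rewrite scaleNr scalerBr scalerN scalerA divff// scale1r opprB opprK addrC.
  rewrite rnormZ rnormN mulrC ler_wpM2l ?rnorm_ge0//.
  by apply: dV; apply/(subspaceN sV)/(subspaceZ sV).
apply/closed_seqP => u l Hu ul.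
have /choice[vc Hvc] : forall n, exists vc : H * R[i]^o, V vc.1 /\ u n = vc.1 + vc.2 *: e.
  by move=> n; have [v [c vcE]] := Hu n; exists (v, c).
have [a ca] : exists a : R[i]^o, (fun n => (vc n).2) @ \oo --> a.
  apply: complex_cauchy_cvg => r r0.
  have /cvg_rnormP/(_ (d * r / 2))[|N HN] := ul; first by rewrite divr_gt0// mulr_gt0.
  exists N => n Nn; rewrite -(ltr_pM2l d0).
  apply: (@le_lt_trans _ _ (rnorm (u n - u N))).
    rewrite (Hvc n).2 (Hvc N).2 opprD addrACA -scalerBl; apply: dist.
    by apply: subspaceB => //; [exact: (Hvc n).1|exact: (Hvc N).1].
  have := ler_rnormB (u n - l) (u N - l); have := HN _ Nn; have := HN _ (leqnn N).
  by rewrite opprB addrA subrK; lra.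
exists (l - a *: e), a; split; last by rewrite subrK.
move/closed_seqP: cV => /(_ (fun n => u n - (vc n).2 *: e)); apply.
  by move=> n; rewrite (Hvc n).2 addrK; exact: (Hvc n).1.
by apply: cvgB => //; exact: scalar_cvg.
Qed.

Lemma closed_sum_finite_dim V F :
  is_subspace V -> closed V -> finite_dim F -> closed (sumset V F).
Proof.
move=> sV cV; elim/finite_dim_ind => [|{}F e fF IH]; first by rewrite sumset0.
rewrite sumset_add_line; apply: closed_add_line => //.
by apply: subspace_sumset => //; exact: finite_dim_subspace.
Qed.

Lemma closed_finite_dim F : finite_dim F -> closed F.
Proof.
move=> fF; rewrite -(_ : sumset [set 0] F = F); last first.
  apply/seteqP; split=> [_ [_ -> [x Fx <-]]|x Fx]; first by rewrite add0r.
  by exists 0 => //; exists x; rewrite ?add0r.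
apply: closed_sum_finite_dim => //; first exact: subspace_set0.
apply/closed_seqP => u l u0 ul; apply: (cvg_inj ul).
by rewrite (_ : u = fun=> 0); [exact: cvg_cst|apply/funext => n; exact: u0].
Qed.

Definition closed_on D S :=
  forall (u : nat -> H) x y, (forall n, D (u n)) -> u @ \oo --> x ->
    (fun n => S (u n)) @ \oo --> y -> D x /\ S x = y.

Lemma closed_opP (T : operator H) : closed_op T <-> closed_on (dom T) T.
Proof.
split=> [/closed_seqP cT u x y Du ux Sy|cT].
  have uT : (fun n => (u n, T (u n))) @ \oo --> (x, y) by apply: cvg_pair.
  have [n|/= Dx yE] := cT (fun n => (u n, T (u n))) (x, y) _ uT; last by split.
  by split=> /=.
apply/closed_seqP => u [x y] Hu ul.
have u1 : (fun n => (u n).1) @ \oo --> x by apply: cvg_comp ul _; exact: cvg_fst.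
have u2 : (fun n => T (u n).1) @ \oo --> y.
  rewrite (_ : (fun n => _) = fun n => (u n).2); last by apply/funext => n; rewrite (Hu n).2.
  by apply: cvg_comp ul _; exact: cvg_snd.
by have [Dx Tx] := cT _ _ _ (fun n => (Hu n).1) u1 u2; split.
Qed.

Lemma closed_onI D V S : closed_on D S -> closed V -> closed_on (D `&` V) S.
Proof.
move=> cS cV u x y Hu ux Sy.
have [Dx Sx] := cS _ _ _ (fun n => (Hu n).1) ux Sy; split => //; split => //.
by move/closed_seqP: cV => cV; apply: (cV u) => // n; exact: (Hu n).2.
Qed.

(** Baire category in a closed set [K]: if no [P k] is dense near any point of [K],
in the sense that a smaller ball avoiding [P k] can be found in any ball, then
nested balls shrink to a point of [K] outside every [P k]. *)
Lemma nested_balls K (P : nat -> H -> Prop) : closed K -> K !=set0 ->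
  (forall k y0 (r : R), K y0 -> 0 < r -> exists y (e : R),
    [/\ K y, 0 < e, rnorm (y - y0) < r &
        forall z, rnorm (z - y) <= e -> ~ P k z]) ->
  exists2 y, K y & forall k, ~ P k y.
Proof.
move=> cK [y0 Ky0] HP.
(* A ball is a centre and a radius. Bounding the move of the centre by the
   decrease of the radius makes the balls nested. *)
pose good (s : nat * (H * R)) (t : H * R) :=
  [/\ K t.1, 0 < t.2, rnorm (t.1 - s.2.1) <= s.2.2 - t.2, t.2 <= s.2.2 / 2 &
      forall z, rnorm (z - t.1) <= t.2 -> ~ P s.1 z].
have step (s : nat * (H * R)) : exists t : H * R, K s.2.1 /\ 0 < s.2.2 -> good s t.
  case: s => k [x r]; have [[/= Kx r0]|ns] := pselect (K x /\ 0 < r); last by exists (x, r).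
  have r20 : 0 < r / 2 by rewrite divr_gt0.
  have [y [e [Ky e0 yx He]]] := HP k x _ Kx r20.
  exists (y, minr e (r / 2)) => _; split=> //=.
  - by rewrite lt_min e0.
  - have : minr e (r / 2) <= r / 2 by rewrite ge_min lexx orbT.
    lra.
  - by rewrite ge_min lexx orbT.
  - by move=> z zy; apply: He; apply: le_trans zy _; rewrite ge_min lexx.
have [f Hf] := choice step.
pose s := fix s n := if n is m.+1 then f (m, s m) else (y0, 1).
have sok n : K (s n).1 /\ 0 < (s n).2.
  by elim: n => [|n IH]; [split => //=|have [] := Hf (n, s n) IH].
have sS n : good (n, s n) (s n.+1) by apply: Hf; exact: sok.
pose y n := (s n).1; pose r n := (s n).2.
have ball k m : rnorm (y (k + m)%N - y k) <= r k - r (k + m)%N.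
  elim: m => [|m IH]; first by rewrite addn0 !subrr rnorm0.
  rewrite addnS; have [_ _ /= le _ _] := sS (k + m)%N.
  have := ler_rnormD (y (k + m).+1 - y (k + m)%N) (y (k + m)%N - y k).
  rewrite addrA subrK; rewrite /y /r in IH le *; lra.
have ball' k m : (k <= m)%N -> rnorm (y m - y k) <= r k.
  by move=> /subnKC <-; have := ball k (m - k)%N; have [_] := sok (k + (m - k))%N; rewrite /r; lra.
have rle n : r n <= 2^-1 ^+ n.
  elim: n => [|n IH]; first by rewrite expr0.
  by have [_ _ _ /= le _] := sS n; rewrite half_powS; rewrite /r in IH *; lra.
have [l yl] : exists l : H, y @ \oo --> l.
  apply: rnorm_cauchy_cvg => e /(half_pow_small 1)[N]; rewrite mul1r => HN.
  by exists N => n /ball' le; apply: le_lt_trans le (le_lt_trans (rle N) HN).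
exists l; first by move/closed_seqP: cK => /(_ y l); apply => // n; exact: (sok n).1.
move=> k; have [_ _ _ _ /= nP] := sS k; apply: nP.
have yl' : (fun n => y (n + k.+1)%N - y k.+1) @ \oo --> l - y k.+1.
  apply: cvgB; last exact: cvg_cst.
  by rewrite (cvg_shiftn k.+1 y).
apply: (rnorm_lim_le _ yl') => n.
by apply: ball'; rewrite leq_addl.
Qed.

(** The open mapping theorem for the map [(x, n) |-> S x + n] on [D * N], where the
graph of [S] and the subspace [N] are closed. The summand [N] is what lets it apply
to operators whose range is only known to have a complement. *)
Section OpenMapping.
Variables (D N : set H) (S : H -> H).
Hypotheses (sD : is_subspace D) (lS : linear_on D S) (cS : closed_on D S).
Hypotheses (sN : is_subspace N) (cN : closed N).
Let K := sumset (S @` D) N.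
Hypothesis cK : closed K.

Let sK : is_subspace K.
Proof. by apply: subspace_sumset => //; exact: subspace_image. Qed.

(** Membership in the closure of the image of the ball of radius [k]. *)
Let approx (k : R) y := forall e : R, 0 < e -> exists x n,
  [/\ D x, N n, rnorm x <= k, rnorm n <= k & rnorm (y - (S x + n)) < e].

Lemma somewhere_dense_approx :
  exists k y0 (r : R), [/\ K y0, 0 < r &
    forall y, K y -> rnorm (y - y0) < r -> approx k y].
Proof.
apply: contrapT => nd.
pose P (k : nat) y := exists x n,
  [/\ D x, N n, rnorm x <= k%:R, rnorm n <= k%:R & y = S x + n].
have [ | | |y [_ [x Dx <-] [n Nn yE]]] := @nested_balls K P.
- exact: cK.
- by exists 0; exact: (subspace0 sK).
- move=> k y0 r Ky0 r0.
  have [y [Ky yr nay]] : exists y, [/\ K y, rnorm (y - y0) < r & ~ approx k%:R y].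
    apply: contrapT => ny; apply: nd; exists k%:R, y0, r; split => // y Ky yr.
    by apply: contrapT => nay; apply: ny; exists y.
  have /existsNP[e /not_implyP[e0 He]] := nay.
  exists y, (e / 2); split => //; first by rewrite divr_gt0.
  move=> z zy [x [n [Dx Nn xk nk zE]]]; apply: He; exists x, n; split => //.
  by rewrite -zE rnormB; lra.
pose k := (truncn (Num.max (rnorm x) (rnorm n))).+1.
move=> /(_ k); apply; exists x, n; split => //.
- by apply: ltW; apply: le_lt_trans (truncnS_gt _); rewrite le_max lexx.
- by apply: ltW; apply: le_lt_trans (truncnS_gt _); rewrite le_max lexx orbT.
Qed.

(** A ball around [y0] in [K] is approximated by images of bounded vectors; taking
differences moves it to the origin, and scaling reaches all of [K]. *)
Lemma approximate_preimages :
  exists2 C : R, 0 <= C & forall y, K y -> exists x n,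
    [/\ D x, N n, rnorm x <= C * rnorm y, rnorm n <= C * rnorm y &
        rnorm (y - (S x + n)) <= rnorm y / 2].
Proof.
have [k [y0 [r [Ky0 r0 Hy]]]] := somewhere_dense_approx.
have k0 : 0 <= k.
  have [||x [n [_ _ xk _ _]]] := Hy y0 Ky0 _ 1 => //.
    by rewrite subrr rnorm0.
  by apply: le_trans (rnorm_ge0 _) xk.
exists (4 * k / r) => [|y Ky]; first by rewrite divr_ge0 ?mulr_ge0// ltW.
have [->|y_neq0] := eqVneq y 0.
  exists 0, 0; rewrite (linear_on0 sD lS) addr0 subr0 !rnorm0 mulr0 mul0r.
  by split => //; [exact: (subspace0 sD)|exact: (subspace0 sN)].
have ny0 : 0 < rnorm y by rewrite rnorm_gt0.
(* [t *: y] has norm [r / 2], so that [y0 + t *: y] lies in the ball. *)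
pose t : R := r / (2 * rnorm y).
have t0 : 0 < t by rewrite divr_gt0// mulr_gt0.
have tE : t * rnorm y = r / 2 by rewrite /t invfM mulrA mulfVK ?gt_eqF.
have tC : rnorm (t%:C) = t by rewrite rnormC gtr0_norm.
have tC0 : t%:C != 0 by rewrite -rnorm_eq0 tC gt_eqF.
(* Two errors of [r / 8] divided by [t] make [rnorm y / 2]. *)
have e0 : 0 < r / 8 by rewrite divr_gt0.
have [||x1 [n1 [Dx1 Nn1 x1k n1k near1]]] := Hy (y0 + t%:C *: y) _ _ _ e0.
- by apply: subspaceD => //; exact: subspaceZ.
- by rewrite addrAC subrr add0r rnormZ tC tE; lra.
have [|x0 [n0 [Dx0 Nn0 x0k n0k near0]]] := Hy y0 Ky0 _ _ e0.
  by rewrite subrr rnorm0.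
have scal z z' : rnorm z <= k -> rnorm z' <= k ->
    rnorm ((t%:C)^-1 *: (z - z')) <= 4 * k / r * rnorm y.
  move=> zk zk'; rewrite rnormZ rnormV tC ler_pdivrMl//.
  have -> : t * (4 * k / r * rnorm y) = 4 * k / r * (t * rnorm y) by ring.
  rewrite tE (_ : 4 * k / r * (r / 2) = 2 * k); last by field; rewrite gt_eqF.
  by have := ler_rnormB z z'; lra.
exists ((t%:C)^-1 *: (x1 - x0)), ((t%:C)^-1 *: (n1 - n0)); split.
- by apply: (subspaceZ sD); apply: subspaceB.
- by apply: (subspaceZ sN); apply: subspaceB.
- exact: scal.
- exact: scal.
rewrite (linear_onZ sD lS) ?(linear_onB lS)//; last exact: subspaceB.
rewrite -scalerDr -(ler_pM2l t0) -{1}tC -rnormZ scalerBr scalerA mulfV// scale1r.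
have -> : t%:C *: y - (S x1 - S x0 + (n1 - n0)) =
   (y0 + t%:C *: y - (S x1 + n1)) - (y0 - (S x0 + n0)).
  rewrite (addrACA (S x1)) -opprD (opprB (S x1 + n1)) (opprB y0) [RHS]addrC.
  by rewrite -(addrA y0) [RHS]addrA subrK addrCA.
apply: le_trans (ler_rnormB _ _) _.
by rewrite mulrA tE; lra.
Qed.

(** Iterating the approximation on the remainders, which are halved at each step,
the preimages sum to geometric series; closedness of the graph identifies the
image of the limit. *)
Lemma bounded_preimages :
  exists2 C : R, 0 < C & forall y, K y -> exists x n,
    [/\ D x, N n, y = S x + n, rnorm x <= C * rnorm y & rnorm n <= C * rnorm y].
Proof.
have [C C0 HC] := approximate_preimages.
have /choice[g Hg] : forall y, exists g : H * H, K y ->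
    [/\ D g.1, N g.2, rnorm g.1 <= C * rnorm y, rnorm g.2 <= C * rnorm y &
        rnorm (y - (S g.1 + g.2)) <= rnorm y / 2].
  move=> y; have [/HC[x [n Hxn]]|nKy] := pselect (K y); last by exists (0, 0).
  by exists (x, n).
exists (2 * C + 1) => [|y Ky]; first by lra.
pose res := fix res m := if m is k.+1 then
  res k - (S (g (res k)).1 + (g (res k)).2) else y.
have Kres m : K (res m).
  elim: m => [//|m IH] /=; apply: subspaceB => //.
  have [Dg Ng _ _ _] := Hg _ IH; exists (S (g (res m)).1); first by exists (g (res m)).1.
  by exists (g (res m)).2.
have res_le m : rnorm (res m) <= rnorm y * 2^-1 ^+ m.
  elim: m => [|m IH]; first by rewrite expr0 mulr1.
  by have [_ _ _ _ le] := Hg _ (Kres m); rewrite half_powS /=; lra.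
pose x m := (g (res m)).1; pose n m := (g (res m)).2.
have bound z m : rnorm z <= C * rnorm (res m) -> rnorm z <= C * rnorm y * 2^-1 ^+ m.
  by move=> le; apply: le_trans le _; rewrite -mulrA ler_wpM2l.
have Dx m : D (x m) by have [] := Hg _ (Kres m).
have Nn m : N (n m) by have [] := Hg _ (Kres m).
have [|X [xX X_le]] := @geometric_series_cvg _ _ x (C * rnorm y).
  by move=> m; apply: bound; have [] := Hg _ (Kres m).
have [|Y [nY Y_le]] := @geometric_series_cvg _ _ n (C * rnorm y).
  by move=> m; apply: bound; have [] := Hg _ (Kres m).
have sumE m : S (\sum_(k < m) x k) = y - res m - \sum_(k < m) n k.
  rewrite (linear_on_sum sD lS)//.
  elim: m => [|m IH]; first by rewrite !big_ord0 subrr subr0.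
  rewrite !big_ord_recr IH /= -/(x m) -/(n m).
  rewrite [in RHS]opprB [S (x m) + n m - _]addrC !addrA.
  by rewrite [X in _ = _ - X]addrC addrKA [LHS]addrAC.
have res0 : res @ \oo --> 0.
  apply/cvg_rnormP => e /(half_pow_small (rnorm y))[M HM]; exists M => m Mm.
  rewrite subr0; apply: le_lt_trans (res_le m) _; apply: le_lt_trans HM.
  apply: ler_wpM2l; first exact: rnorm_ge0.
  by apply: ler_wiXn2l => //; rewrite ?invr_ge0 ?invf_le1 ?ler1n.
have Dsum m : D (\sum_(k < m) x k) by exact: (subspace_sum sD).
have [|DX SX] := @cS (fun m => \sum_(k < m) x k) X (y - Y) Dsum xX.
  rewrite (_ : (fun m => _) = fun m => y - res m - \sum_(k < m) n k); last exact/funext.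
  by rewrite -[y in y - Y]subr0; apply: cvgB => //; apply: cvgB => //; exact: cvg_cst.
exists X, Y; split => //.
- move/closed_seqP: cN => /(_ _ _ _ nY); apply=> m; exact: (subspace_sum sN).
- by rewrite SX subrK.
- by apply: le_trans X_le _; have := rnorm_ge0 y; lra.
- by apply: le_trans Y_le _; have := rnorm_ge0 y; lra.
Qed.

End OpenMapping.
End ClosedSubspaces.

(** * Closed ranges and the punctured neighbourhood theorem *)

Section FredholmOperators.
Variables (R : realType) (H : completeNormedModType R[i]).
Implicit Types (K M N V F : set H) (x y e : H).

Section ClosedRange.
Variables (D : set H) (S : H -> H).
Hypotheses (sD : is_subspace D) (lS : linear_on D S) (cS : closed_on D S).

(** Shrink [F] to a complement [F'] of the range and let [u k] in the range tend to
[y = v + n]. Then [y - u k] tends to 0, hence so does its component in [F'] by the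
open mapping theorem; as the decomposition is unique, this component is [n]. *)
Lemma closed_range_finite_codim K F :
  closed K -> finite_dim F -> K = sumset (S @` D) F -> closed (S @` D).
Proof.
move=> cK fF KE; have sV := subspace_image sD lS.
have [F' [fF' VF' VF'0]] := finite_dim_complement sV fF.
have sF' := finite_dim_subspace fF'.
have cK' : closed (sumset (S @` D) F') by rewrite VF' -KE.
have [C C0 HC] := bounded_preimages sD lS cS sF' (closed_finite_dim fF') cK'.
apply/closed_seqP => u y Vu uy.
have sK := subspace_sumset sV sF'.
have VK v : (S @` D) v -> sumset (S @` D) F' v.
  by move=> Vv; exists v => //; exists 0; rewrite ?addr0//; exact: (subspace0 sF').
have Ky : sumset (S @` D) F' y.
  by move/closed_seqP: cK' => /(_ u y); apply => // n; exact: VK.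
have [v Vv [n Fn yE]] := Ky.
suff n0 : n = 0 by rewrite -yE n0 addr0.
have cn : (fun k : nat => n) @ \oo --> (0 : H).
  apply: (@cvg_rnorm_le _ _ _ _ _ u y C) uy => k.
  have [x [m [Dx Fm ukE _ mC]]] := HC (y - u k) (subspaceB sK Ky (VK _ (Vu k))).
  suff <- : m = n by rewrite subr0 rnormB.
  apply/eqP; rewrite -subr_eq0; apply/eqP.
  suff : ((S @` D) `&` F') (m - n) by rewrite VF'0.
  split; last exact: subspaceB.
  have -> : m - n = v - u k - S x.
    apply: (addIr (S x)); rewrite subrK addrAC [m + _]addrC -ukE -yE.
    by rewrite addrAC addrK.
  by apply: (subspaceB sV); [apply: (subspaceB sV)|exists x].
exact: (cvg_inj (cvg_cst n) cn).
Qed.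

Lemma bounded_preimages_range : closed (S @` D) ->
  exists2 C : R, 0 < C & forall y, (S @` D) y -> exists x,
    [/\ D x, S x = y & rnorm x <= C * rnorm y].
Proof.
rewrite -(sumset0 (S @` D)) => cK.
have [C C0 HC] := bounded_preimages sD lS cS (@subspace_set0 _ H)
  (closed_finite_dim (@finite_dim0 _ H)) cK.
exists C => // y /HC[x [_ [Dx -> yE xC _]]].
by exists x; rewrite yE addr0 -[S x]addr0 -yE.
Qed.

(** If images [S m_k] with [m_k] in [M] tend to [S x0], small preimages [d k] of the
differences show that [x0] is a limit of elements of [M + ker S], which is closed
as the kernel is finite-dimensional. *)
Lemma closed_image_finite_ker M :
  closed (S @` D) -> finite_dim (D `&` [set x | S x = 0]) ->
  is_subspace M -> closed M -> closed (S @` (D `&` M)).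
Proof.
move=> cR fK sM cM; have [C C0 HC] := bounded_preimages_range cR.
have sV := subspace_image sD lS.
apply/closed_seqP => u y Hu uy.
have Vu k : (S @` D) (u k) by have [x [Dx _] <-] := Hu k; exists x.
have Vy : (S @` D) y by move/closed_seqP: (cR) => /(_ u y); apply.
have [x0 Dx0 yE] := Vy.
have /choice[d Hd] : forall k, exists d, [/\ D d, S d = y - u k & rnorm d <= C * rnorm (y - u k)].
  by move=> k; apply: HC; exact: subspaceB.
have d0 : d @ \oo --> (0 : H).
  apply: (@cvg_rnorm_le _ _ _ _ _ u y C) uy => k.
  by rewrite subr0 rnormB; have [_ _] := Hd k; rewrite rnormB.
have x0d : (fun k => x0 - d k) @ \oo --> x0.
  by rewrite -[X in _ --> X]subr0; apply: cvgB => //; exact: cvg_cst.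
have /closed_seqP/(_ _ _ _ x0d)[k|m Mm [z [Dz Sz] x0E]] := closed_sum_finite_dim sM cM fK.
  have [Ddk Sdk _] := Hd k; have [m [Dm Mm] mE] := Hu k.
  exists m => //; exists (x0 - d k - m); last by rewrite addrC subrK.
  have Dx0d := subspaceB sD Dx0 Ddk.
  split; first exact: subspaceB.
  by rewrite /= (linear_onB lS)// (linear_onB lS)// Sdk mE yE subKr subrr.
have mE : m = x0 - z by rewrite -x0E addrK.
have Dm : D m by rewrite mE; exact: subspaceB.
by exists m => //; rewrite mE (linear_onB lS)// Sz subr0.
Qed.

End ClosedRange.

Section PuncturedNeighbourhood.
Variables (D : set H) (S : H -> H).
Hypotheses (sD : is_subspace D) (lS : linear_on D S) (cS : closed_on D S).
Hypotheses (cR : closed (S @` D)) (fK : finite_dim (D `&` [set x | S x = 0])).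

(** The range of the [n]-th power of [S], with its natural domain. *)
Fixpoint iter_range n : set H :=
  if n is m.+1 then S @` (D `&` iter_range m) else setT.

Definition core : set H := \bigcap_n iter_range n.

Let lSI V : linear_on (D `&` V) S.
Proof. by apply: linear_onW lS => x []. Qed.

Lemma iter_range_subspace n : is_subspace (iter_range n).
Proof.
elim: n => [|n IH] /=; first exact: subspace_setT.
by apply: subspace_image; [exact: subspaceI|exact: lSI].
Qed.

Lemma iter_range_closed n : closed (iter_range n).
Proof.
elim: n => [|n IH] /=; first exact: closedT.
by apply: closed_image_finite_ker => //; exact: iter_range_subspace.
Qed.

Lemma iter_range_decr n : iter_range n.+1 `<=` iter_range n.
Proof.
elim: n => [//|n IH] _ [x [Dx Mx] <-].
by exists x => //; split => //; exact: IH.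
Qed.

Lemma iter_range_le m n : (m <= n)%N -> iter_range n `<=` iter_range m.
Proof.
move=> /subnKC <-; elim: (n - m)%N => [|k IH]; first by rewrite addn0.
by rewrite addnS => x /iter_range_decr/IH.
Qed.

Lemma core_subspace : is_subspace core.
Proof.
apply/subspaceP; split=> [n _|c x y Cx Cy n _].
  exact: (subspace0 (iter_range_subspace n)).
by apply: (subspaceDZ (iter_range_subspace n)); [exact: Cx|exact: Cy].
Qed.

Lemma core_closed : closed core.
Proof. by apply: closed_bigI => n _; exact: iter_range_closed. Qed.

(** For [y] in the core, the preimages of [y] in the successive iterated ranges form
cosets of the decreasing spaces [ker S] intersected with [iter_range n]. These are
eventually constant, so a preimage taken far enough lies in all of them. *)
Lemma core_image : S @` (D `&` core) = core.
Proof.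
apply/seteqP; split=> [_ [x [Dx Cx] <-] [|n] _//|y Cy].
  by exists x => //; split=> //; exact: Cx.
have [ | | |N HN] := @decreasing_finite_dim_stable _ _ _
    (fun n => (D `&` [set x | S x = 0]) `&` iter_range n) fK.
- by move=> n; apply: (subspaceI (finite_dim_subspace fK)); exact: iter_range_subspace.
- by move=> n x [].
- by move=> n x [Kx /iter_range_decr Mx].
have [x [Dx Mx] Sx] := Cy N.+1 I.
exists x => //; split=> // n _.
have [nN|/ltnW Nn] := leqP n N; first exact: iter_range_le Mx.
have [x' [Dx' Mx'] Sx'] := Cy n.+1 I.
have sM := iter_range_subspace.
suff [_ Mxx'] : ((D `&` [set x | S x = 0]) `&` iter_range n) (x - x').
  by rewrite -(subrK x' x); apply: (subspaceD (sM n)).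
rewrite HN//; split; last by apply: (subspaceB (sM N)) => //; exact: iter_range_le Mx'.
by split; [exact: subspaceB|rewrite /= (linear_onB lS)// Sx Sx' subrr].
Qed.

Lemma eigenvector_core (c : R[i]) x : D x -> c != 0 -> S x = c *: x -> core x.
Proof.
move=> Dx c0 Sx n _; elim: n => [//|n IH] /=.
exists (c^-1 *: x); last by rewrite (linear_onZ sD lS)// Sx scalerA mulVf// scale1r.
by split; [exact: subspaceZ|apply: (subspaceZ (iter_range_subspace n))].
Qed.

(** Formally [S] applied to the sum of [c ^+ k *: z k] shifts the series by one index,
which multiplies it by [c]. *)
Lemma eigenvector_series (C : R) (z : nat -> H) (c : R[i]) :
  (forall k, D (z k)) -> S (z 0%N) = 0 -> z 0%N != 0 ->
  (forall k, S (z k.+1) = z k) -> (forall k, rnorm (z k.+1) <= C * rnorm (z k)) ->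
  0 < C -> rnorm c * C <= 4^-1 ->
  exists x, [/\ D x, x != 0 & S x = c *: x].
Proof.
move=> Dz Sz0 z0 Sz zC C0 cC.
pose w k := c ^+ k *: z k.
have wS k : rnorm (w k.+1) <= 4^-1 * rnorm (w k).
  rewrite /w !rnormZ exprS rnormM.
  have := zC k; have := rnorm_ge0 (c ^+ k); have := rnorm_ge0 c; have := rnorm_ge0 (z k).
  move=> a0 b0 d0 le.
  apply: (@le_trans _ _ (rnorm c * rnorm (c ^+ k) * (C * rnorm (z k)))).
    by apply: ler_wpM2l => //; exact: mulr_ge0.
  rewrite (_ : _ * _ = (rnorm c * C) * (rnorm (c ^+ k) * rnorm (z k))); last by ring.
  by apply: ler_wpM2r => //; exact: mulr_ge0.
(* The factor 1/4 bounds the tail by half of the norm of [z 0], so that the sum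
   does not vanish. *)
have w_le k : rnorm (w k.+1) <= rnorm (z 0%N) / 4 * 2^-1 ^+ k.
  elim: k => [|k IH].
    by have := wS 0%N; rewrite {2}/w expr0 scale1r mulr1; lra.
  have := wS k.+1; rewrite half_powS; have := rnorm_ge0 (w k.+1); lra.
have [t [wt t_le]] := geometric_series_cvg w_le.
have Dw k : D (w k) by apply: subspaceZ.
pose s n := \sum_(k < n) w k.
have sS n : s n.+1 = z 0%N + \sum_(k < n) w k.+1.
  by rewrite /s big_ord_recl /w expr0 scale1r; congr (_ + _); apply: eq_bigr.
have st : (fun n => s n.+1) @ \oo --> z 0%N + t.
  rewrite (_ : (fun n => _) = fun n => z 0%N + \sum_(k < n) w k.+1); last exact/funext.
  by apply: cvgD => //; exact: cvg_cst.
have Ss n : S (s n.+1) = c *: s n.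
  rewrite /s (linear_on_sum sD lS)// big_ord_recl/= {1}/w expr0 scale1r Sz0 add0r.
  rewrite scaler_sumr; apply: eq_bigr => k _ /=.
  by rewrite /w (linear_onZ sD lS)// Sz scalerA exprS.
have st' : s @ \oo --> z 0%N + t.
  apply/cvg_rnormP => e e0; have /cvg_rnormP/(_ _ e0)[N HN] := st.
  by exists N.+1 => [[|n]]//; rewrite ltnS => /HN.
have Sst : (fun n => S (s n.+1)) @ \oo --> c *: (z 0%N + t).
  rewrite (_ : (fun n => _) = fun n => c *: s n); last exact/funext.
  by apply: cvgZr.
have Ds n : D (s n.+1) by exact: (subspace_sum sD).
have [Dx Sx] := @cS _ _ _ Ds st Sst.
exists (z 0%N + t); split=> //; apply/eqP => zt.
have := t_le; rewrite (_ : t = - z 0%N); last by rewrite -(addKr (z 0%N) t) zt addr0.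
have : 0 < rnorm (z 0%N) by rewrite rnorm_gt0.
by rewrite rnormN; lra.
Qed.

Definition eigenvalue_on (c : R[i]) := exists x, [/\ D x, x != 0 & S x = c *: x].

(** The core is a closed space that [S] maps onto itself, so the open mapping theorem
applies there; which alternative holds depends on the injectivity of [S] on the
core. *)
Theorem punctured_neighbourhood :
  exists2 r : R, 0 < r &
    (forall c, 0 < rnorm c < r -> eigenvalue_on c) \/
    (forall c, 0 < rnorm c < r -> ~ eigenvalue_on c).
Proof.
have sDC := subspaceI sD core_subspace.
have [|C C0 HC] := bounded_preimages_range sDC (@lSI _) (closed_onI cS core_closed).
  by rewrite core_image; exact: core_closed.
rewrite core_image in HC.
have [[z0 [Dz0 Cz0 Sz0 z0_neq0]]|ninj] :=
    pselect (exists z, [/\ D z, core z, S z = 0 & z != 0]).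
  exists (C * 4)^-1; first by rewrite invr_gt0 mulr_gt0.
  left=> c /andP[c0 cC].
  have /choice[f Hf] : forall y, exists x, core y ->
      [/\ D x, core x, S x = y & rnorm x <= C * rnorm y].
    move=> y; have [/HC[x [[Dx Cx] Sx xC]]|nCy] := pselect (core y); last by exists 0.
    by exists x.
  pose z := fix z n := if n is m.+1 then f (z m) else z0.
  have Cz k : core (z k) by elim: k => [//|k IH] /=; have [] := Hf _ IH.
  apply: (@eigenvector_series C z) => //.
  - by case=> [//|k]; have [] := Hf _ (Cz k).
  - by move=> k; have [] := Hf _ (Cz k).
  - by move=> k; have [] := Hf _ (Cz k).
  - by rewrite -ler_pdivlMr// -invfM mulrC ltW.
exists C^-1; first by rewrite invr_gt0.
right=> c /andP[c0 cC] [x [Dx x0 Sx]].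
have c_neq0 : c != 0 by rewrite -rnorm_gt0.
have Cx := eigenvector_core Dx c_neq0 Sx.
have [x' [[Dx' Cx'] Sx' x'C]] := HC (c *: x) (subspaceZ core_subspace c Cx).
have xx' : x = x'.
  apply/eqP; rewrite -subr_eq0; apply/eqP; apply: contrapT => xx'.
  apply: ninj; exists (x - x'); split; [exact: subspaceB| | |exact/eqP].
    by apply: (subspaceB core_subspace).
  by rewrite (linear_onB lS)// Sx Sx' subrr.
have := x'C; rewrite -xx' rnormZ mulrA ler_pMl ?rnorm_gt0//.
by rewrite leNgt -ltr_pdivlMl// mulr1 cC.
Qed.

End PuncturedNeighbourhood.
End FredholmOperators.

(** * Dichotomies on connected open sets of complex numbers *)

Section Dichotomy.
Variables (R : realType) (E : set R[i]^o).
Implicit Types (c : R[i]^o) (P : set R[i]^o).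

(** No condition is put at [c] itself, which may or may not be an eigenvalue. *)
Definition near_punctured P c :=
  exists2 r : R, 0 < r & forall d : R[i]^o, 0 < rnorm (d - c) < r -> P d.

(** A point close to [c] and different from it has a whole neighbourhood in the
punctured disc around [c]. *)
Lemma open_near_punctured P : open (near_punctured P).
Proof.
rewrite openE => c [r r0 Hr]; apply/nbhs_rnormP; exists r => // d dc.
have [->|d_c] := eqVneq d c; first by exists r.
have dc0 : 0 < rnorm (d - c) by rewrite rnorm_gt0 subr_eq0.
exists (minr (rnorm (d - c)) (r - rnorm (d - c))).
  by rewrite lt_min dc0 subr_gt0.
move=> e; rewrite lt_min => /andP[ed0 /andP[ed1 ed2]]; apply: Hr.
have := ler_rnormD (e - d) (d - c); rewrite addrA subrK => le1.
have := ler_rnormD (e - c) (d - e).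
rewrite [(e - c) + _]addrC addrA subrK (rnormB d e) => le2.
by apply/andP; split; lra.
Qed.

Lemma near_punctured_disjoint P c :
  near_punctured P c -> near_punctured (~` P) c -> False.
Proof.
move=> [r r0 Hr] [s s0 Hs].
pose d : R[i]^o := c + (minr r s / 2)%:C.
have t0 : 0 < minr r s by rewrite lt_min r0.
have dE : rnorm (d - c) = minr r s / 2.
  by rewrite addrAC subrr add0r rnormC ger0_norm// divr_ge0// ltW.
have tr : minr r s <= r by rewrite ge_min lexx.
have ts : minr r s <= s by rewrite ge_min lexx orbT.
by apply: (Hs d); [rewrite dE; apply/andP; split; lra|apply: Hr; rewrite dE; apply/andP; split; lra].
Qed.

Lemma connected_dichotomy (Om : set R[i]^o) : connected Om ->
  (forall c, Om c -> near_punctured E c \/ near_punctured (~` E) c) ->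
  Om `&` near_punctured (~` E) !=set0 -> Om `<=` near_punctured (~` E).
Proof.
move=> cOm HE ne.
have BE : Om `&` near_punctured (~` E) = Om `&` ~` near_punctured E.
  apply/seteqP; split=> [c [Oc nc]|c [Oc nc]]; split=> //.
    by move=> /near_punctured_disjoint; apply.
  by have [] := HE c Oc.
have <- : Om `&` near_punctured (~` E) = Om by apply: cOm => //;
  [exists (near_punctured (~` E)) => //; exact: open_near_punctured
  |exists (~` near_punctured E) => //; exact/open_closedC/open_near_punctured].
by move=> c [].
Qed.

Lemma floor_eq_dist (x y : R) : Num.floor x = Num.floor y -> `|x - y| < 1.
Proof.
move=> xy; have := floor_itv x; have := floor_itv y; rewrite xy intrD.
move=> /andP[? ?] /andP[? ?]; rewrite ltr_norml; apply/andP; split; lra.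
Qed.

(** A point with exclusion radius [r] is encoded by an [n] with [2 / n.+1 < r] and by
the cell of the grid of mesh [1 / n.+1] that contains it. Two points of [E] in the
same cell would be within distance [r] of each other. *)
Lemma countable_near_punctured (Om : set R[i]^o) :
  Om `<=` near_punctured (~` E) -> countable (Om `&` E).
Proof.
move=> OmE.
have /choice[r Hr] : forall c, exists r : R, Om c ->
    0 < r /\ forall d : R[i]^o, 0 < rnorm (d - c) < r -> ~ E d.
  move=> c; have [/OmE[r r0 Hr]|nOc] := pselect (Om c); last by exists 0.
  by exists r.
pose n c := truncn (2 / r c).
pose f c := (n c, Num.floor (complex.Re c * (n c).+1%:R),
             Num.floor (complex.Im c * (n c).+1%:R)).
apply/countable_injP; exists (fun c => pickle (f c)).
move=> c d /set_mem[Oc Ec] /set_mem[Od Ed] /(pcan_inj (@pickleK _))[nE ReE ImE].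
apply/eqP; apply: contrapT => /negP cd.
have [r0 Hd] := Hr d Od; apply: (Hd c) => //.
rewrite rnorm_gt0 subr_eq0 cd/=.
rewrite -nE in ReE ImE.
have n0 : 0 < (n c).+1%:R :> R by [].
have scaled (x y : R) : Num.floor (x * (n c).+1%:R) = Num.floor (y * (n c).+1%:R) ->
    `|x - y| < (n c).+1%:R^-1.
  move=> /floor_eq_dist; rewrite -mulrBl normrM (gtr0_norm n0) => lt.
  by rewrite -[ltRHS]mul1r ltr_pdivlMr.
have Re_lt := scaled _ _ ReE; have Im_lt := scaled _ _ ImE.
have small : 2 * (n c).+1%:R^-1 < r d.
  rewrite nE ltr_pdivrMr// mulrC -ltr_pdivrMr//.
  exact: truncnS_gt.
apply: le_lt_trans small; apply: le_trans (rnorm_le_ReIm _) _.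
have -> : complex.Re (c - d) = complex.Re c - complex.Re d by case: (c) (d) => ? ? [].
have -> : complex.Im (c - d) = complex.Im c - complex.Im d by case: (c) (d) => ? ? [].
by rewrite mulr_natl mulr2n lerD ?ltW.
Qed.

Lemma limit_point_near_punctured (Om : set R[i]^o) : open Om ->
  Om `<=` near_punctured (~` E) -> limit_point (Om `&` E) `<=` boundary Om.
Proof.
move=> oOm OmE c lc; split.
  by apply: closureS (subset_limit_point lc); exact: subIsetl.
move=> /interior_subset/OmE[r r0 Hr].
have [|d [dc [Od Ed] /= dcr]] := lc [set d | rnorm (d - c) < r].
  by apply/nbhs_rnormP; exists r.
by apply: (Hr d) => //; rewrite dcr andbT rnorm_gt0 subr_eq0.
Qed.

End Dichotomy.

(** * Relatively bounded perturbations *)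

Section RelativelyBounded.
Variables (R : realType) (H : completeNormedModType R[i]).
Variables (D : set H) (T B : H -> H) (a b : R).
Hypotheses (sD : is_subspace D) (lT : linear_on D T) (lB : linear_on D B).
Hypotheses (cT : closed_on D T) (b_lt1 : b < 1).
Hypothesis TB : forall x, D x -> rnorm (B x) <= a * rnorm x + b * rnorm (T x).

(** By the triangle inequality, [T + B - z] and [T] have equivalent graph norms: the
factor [1 - b] in the inequality [TS] below is positive. Hence convergence of
[T + B - z] along a convergent sequence forces convergence of [T]. *)
Lemma closed_on_relatively_bounded (z : R[i]) :
  closed_on D (fun x => T x + B x - z *: x).
Proof.
move=> u x y Du ux Sy.
pose S w := T w + B w - z *: w.
have lS : linear_on D S.
  move=> c v w Dv Dw; rewrite /S lT// lB// !scalerDr scalerN !scalerA [z * c]mulrC.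
  by rewrite (addrACA (c *: T v)) opprD [LHS]addrACA.
have TS w : D w -> (1 - b) * rnorm (T w) <= rnorm (S w) + (a + rnorm z) * rnorm w.
  move=> Dw; have TE : T w = S w + (z *: w - B w) by rewrite /S addrA subrK addrK.
  have := ler_rnormD (S w) (z *: w - B w); rewrite -TE.
  by have := ler_rnormB (z *: w) (B w); have := TB Dw; rewrite rnormZ; lra.
have b1 : 0 < 1 - b by rewrite subr_gt0.
have [w Tw] : exists w : H, (fun n => T (u n)) @ \oo --> w.
  apply: rnorm_cauchy_cvg => e e0; pose A := `|a + rnorm z| + 1.
  have A0 : 0 < A by rewrite ltr_wpDl.
  have [|N HN] := (cvg_rnormP _ _).1 Sy ((1 - b) * e / 4).
    by rewrite ?(divr_gt0, mulr_gt0).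
  have [|M HM] := (cvg_rnormP _ _).1 ux ((1 - b) * e / (4 * A)).
    by rewrite ?(divr_gt0, mulr_gt0).
  exists (maxn N M) => n; rewrite geq_max => /andP[/HN Sn /HM un].
  have /HN SN := leq_maxl N M; have /HM uN := leq_maxr N M.
  set k := maxn N M in SN uN *.
  rewrite -(linear_onB lT)// -(ltr_pM2l b1).
  apply: le_lt_trans (TS _ (subspaceB sD (Du n) (Du k))) _.
  have dS : rnorm (S (u n - u k)) < (1 - b) * e / 2.
    rewrite (linear_onB lS)//; have := ler_rnormB (S (u n) - y) (S (u k) - y).
    by rewrite opprB addrA subrK; rewrite -/(S (u n)) -/(S (u k)) in Sn SN; lra.
  have du : rnorm (u n - u k) * A < (1 - b) * e / 2.
    have -> : (1 - b) * e / 2 = (2 * ((1 - b) * e / (4 * A))) * A.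
      by field; rewrite gt_eqF.
    rewrite ltr_pM2r//; have := ler_rnormB (u n - x) (u k - x).
    by rewrite opprB addrA subrK; lra.
  have : (a + rnorm z) * rnorm (u n - u k) <= rnorm (u n - u k) * A.
    rewrite mulrC ler_wpM2l ?rnorm_ge0//; have := ler_norm (a + rnorm z).
    by rewrite /A; lra.
  lra.
have [Dx Tx] := cT Du ux Tw; split=> //.
have uBx : (fun n => B (u n)) @ \oo --> B x.
  apply/cvg_rnormP => e e0; pose A := `|a| + 1; pose C := `|b| + 1.
  have A0 : 0 < A by rewrite ltr_wpDl.
  have C0 : 0 < C by rewrite ltr_wpDl.
  have [|N HN] := (cvg_rnormP _ _).1 Tw (e / (2 * C)); first by rewrite ?(divr_gt0, mulr_gt0).
  have [|M HM] := (cvg_rnormP _ _).1 ux (e / (2 * A)); first by rewrite ?(divr_gt0, mulr_gt0).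
  exists (maxn N M) => n; rewrite geq_max => /andP[/HN Tn /HM un].
  rewrite -(linear_onB lB)//; apply: le_lt_trans (TB (subspaceB sD (Du n) Dx)) _.
  rewrite (linear_onB lT)// Tx.
  have : rnorm (u n - x) * A < e / 2.
    by rewrite -ltr_pdivlMr// -mulrA -invfM.
  have : rnorm (T (u n) - w) * C < e / 2.
    by rewrite -ltr_pdivlMr// -mulrA -invfM.
  have : a * rnorm (u n - x) <= rnorm (u n - x) * A.
    by rewrite mulrC ler_wpM2l ?rnorm_ge0//; have := ler_norm a; rewrite /A; lra.
  have : b * rnorm (T (u n) - w) <= rnorm (T (u n) - w) * C.
    by rewrite mulrC ler_wpM2l ?rnorm_ge0//; have := ler_norm b; rewrite /C; lra.
  lra.
apply: (cvg_inj _ Sy); rewrite Tx.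
by apply: cvgB; [exact: cvgD|exact: cvgZr].
Qed.

End RelativelyBounded.

(** * Orthogonal projections and compressions *)

Section OrthogonalProjection.
Variables (R : realType) (H : completeNormedModType R[i]).
Variable dot : {dot H for conjC}.
Implicit Types (V F : set H) (x y h w e : H).

Lemma orthocomp_subspace V : is_subspace (orthocomp dot V).
Proof.
apply/subspaceP; split=> [y _|c x y Vx Vy z Vz]; first by rewrite linear0l.
by rewrite linearDl linearZl_LR/= Vx// Vy// mulr0 addr0.
Qed.

Hypothesis dotE : induces_norm dot.

Lemma orthocomp_disjoint V x : V x -> orthocomp dot V x -> x = 0.
Proof.
move=> Vx /(_ x Vx); rewrite dotE => /eqP.
by rewrite expf_eq0/= normr_eq0 => /eqP.
Qed.

Lemma pythagoras h w : dot w h = 0 ->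
  rnorm (h + w) ^+ 2 = rnorm h ^+ 2 + rnorm w ^+ 2.
Proof.
move=> wh; have hw : dot h w = 0 by rewrite hermC /= wh conjC0 mulr0.
apply: (@complexI R); rewrite realcD !expr2 !realcM -!rnormE -!expr2 -!dotE.
by rewrite linearDl !linearDr/= wh hw addr0 add0r.
Qed.

(** Gram-Schmidt: the new vector [e] is replaced by its component orthogonal to the
space already treated. *)
Lemma orthogonal_decomposition V x : finite_dim V ->
  exists2 h, V h & orthocomp dot V (x - h).
Proof.
move=> fV; elim/finite_dim_ind: V / fV x => [|V e fV IH] x.
  by exists 0 => // _ ->; rewrite linear0r.
have sV := finite_dim_subspace fV.
have [p Vp ep] := IH e; have [h Vh xh] := IH x.
have [ep0|ep0] := eqVneq (e - p) 0.
  have Ve : V e by move/eqP: ep0; rewrite subr_eq0 => /eqP ->.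
  by rewrite (add_line_id sV Ve); exists h.
have dep0 : dot (e - p) (e - p) != 0 by rewrite dotE expf_neq0// normr_eq0.
pose c := dot (x - h) (e - p) / dot (e - p) (e - p).
have cE : c * dot (e - p) (e - p) = dot (x - h) (e - p) by rewrite divfK.
clearbody c; have sVe := subspace_add_line e sV.
exists (h + c *: (e - p)).
  apply: (subspaceD sVe); first exact: sub_add_line.
  apply/(subspaceZ sVe)/(subspaceB sVe); last exact: sub_add_line.
  exact: mem_add_line.
move=> _ [v [d [Vv ->]]].
have -> : v + d *: e = (v + d *: p) + d *: (e - p).
  by rewrite -addrA -scalerDr [p + _]addrC subrK.
have Vvp : V (v + d *: p) by apply: subspaceD => //; exact: subspaceZ.
rewrite opprD addrA; move: (x - h) (e - p) xh ep cE => u q uV qV cE.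
rewrite linearDr/= linearZr_LR/= !linearDl/= !linearNl/= !linearZl_LR/=.
by rewrite (uV _ Vvp) (qV _ Vvp) cE mulr0 !subr0 subrr mulr0 addr0.
Qed.

Section Projection.
Variables (V : set H) (fV : finite_dim V).
Let K := orthocomp dot V.
Let P := orthoproj dot K.

Let sV : is_subspace V. Proof. exact: finite_dim_subspace. Qed.
Let sK : is_subspace K. Proof. exact: orthocomp_subspace. Qed.

Lemma sub_double_orthocomp h : V h -> orthocomp dot K h.
Proof. by move=> Vh w Kw; rewrite hermC /= Kw// conjC0 mulr0. Qed.

(** The projection onto the complement [K] is specified through the complement of
[K]; for the finite-dimensional [V] it is computed by splitting off a vector of
[V], without identifying that double complement. *)
Lemma orthoproj_unique x y : K y -> V (x - y) -> P x = y.
Proof.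
move=> Ky Vxy; rewrite /P /orthoproj.
case: xgetP => [z _ [Kz Kxz]|/(_ y) nP]; last first.
  by case: nP; split => //; exact: sub_double_orthocomp.
apply/eqP; rewrite -subr_eq0; apply/eqP.
apply: (@orthocomp_disjoint K); first exact: (subspaceB sK).
have -> : z - y = (x - y) - (x - z) by rewrite opprB [RHS]addrC addrA subrK.
apply: (subspaceB (orthocomp_subspace K)) => //.
exact: sub_double_orthocomp.
Qed.

Lemma orthoprojP x : K (P x) /\ V (x - P x).
Proof.
have [h Vh Kh] := orthogonal_decomposition x fV.
by rewrite (orthoproj_unique Kh) subKr.
Qed.

Lemma orthoproj_id x : K x -> P x = x.
Proof. by move=> Kx; apply: orthoproj_unique => //; rewrite subrr; exact: (subspace0 sV). Qed.

Lemma orthoproj_linear : linear_on setT P.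
Proof.
move=> c x y _ _; have [Kx Vx] := orthoprojP x; have [Ky Vy] := orthoprojP y.
apply: orthoproj_unique; first exact: (subspaceDZ sK).
by rewrite opprD addrACA -scalerBr; exact: (subspaceDZ sV).
Qed.

Lemma rnorm_orthoproj x : rnorm x ^+ 2 = rnorm (x - P x) ^+ 2 + rnorm (P x) ^+ 2.
Proof.
have [Kx Vx] := orthoprojP x.
by rewrite -pythagoras ?subrK//; exact: Kx.
Qed.

Lemma rnorm_orthoproj_le x : rnorm (P x) <= rnorm x.
Proof.
rewrite -(@ler_pXn2r _ 2)// ?nnegrE ?rnorm_ge0// [leRHS]rnorm_orthoproj.
by rewrite lerDr sqr_ge0.
Qed.

Lemma rnorm_orthoproj_compl_le x : rnorm (x - P x) <= rnorm x.
Proof.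
rewrite -(@ler_pXn2r _ 2)// ?nnegrE ?rnorm_ge0// [leRHS]rnorm_orthoproj.
by rewrite lerDl sqr_ge0.
Qed.

(** The complementary projection is a contraction, so the part of [x] in [V] is at most
the distance from [x] to any point of [K]. *)
Lemma orthocomp_closed : closed K.
Proof.
apply/closed_seqP => u x Ku ux.
suff <- : P x = x by have [] := orthoprojP x.
apply/eqP; rewrite eq_sym -subr_eq0; apply/eqP/rnorm_le0_eq0.
apply/ler_addgt0Pr => e e0; rewrite add0r.
have [N /(_ N (leqnn N)) uN] := (cvg_rnormP _ _).1 ux e e0.
apply: ltW; apply: le_lt_trans uN.
have -> : x - P x = x - u N - P (x - u N).
  rewrite (linear_onB orthoproj_linear)// (orthoproj_id (Ku N)).
  by rewrite opprB addrA subrK.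
rewrite (rnormB (u N)); exact: rnorm_orthoproj_compl_le.
Qed.

End Projection.

Section Compression.
Variables (V D : set H) (S S2 : H -> H).
Let K := orthocomp dot V.
Let P := orthoproj dot K.
Let D2 := D `&` K.
Hypotheses (fV : finite_dim V) (VD : V `<=` D) (sD : is_subspace D).
Hypotheses (DE : D = sumset V D2) (lS : linear_on D S).
Hypothesis S2E : forall x, D2 x -> S2 x = P (S x).

Let sV : is_subspace V. Proof. exact: finite_dim_subspace. Qed.
Let sK : is_subspace K. Proof. exact: orthocomp_subspace. Qed.
Let sD2 : is_subspace D2. Proof. exact: subspaceI. Qed.
Let lP : linear_on setT P. Proof. exact: orthoproj_linear. Qed.

Let lS2 : linear_on D2 S2.
Proof.
move=> c x y Dx Dy; rewrite !S2E//; last exact: subspaceDZ.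
by rewrite lS ?lP//; [case: Dx|case: Dy].
Qed.

Let fP F : finite_dim F -> finite_dim (P @` F).
Proof. by apply: (finite_dim_image (@subspace_setT _ H) lP). Qed.

(** [S] maps the kernel of the compression into [V], and the projection onto [V] maps
the kernel of [S] into [V] with kernel inside that of the compression. *)
Lemma finite_dim_ker_compression :
  finite_dim (D `&` [set x | S x = 0]) <-> finite_dim (D2 `&` [set x | S2 x = 0]).
Proof.
split=> fK.
  apply: (@finite_dim_ker_image _ _ V _ S) => //.
  - exact: (subspace_preimage sD2 lS2 (@subspace_set0 _ H)).
  - by apply: linear_onW lS => x [[]].
  - move=> _ [x [[Dx Kx] /= Sx] <-]; have [_] := orthoprojP fV (S x).
    by rewrite -/K -/P -S2E// Sx subr0.
  - apply: finite_dimS fK; last by move=> x [[[Dx Kx] _] Sx].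
    apply: (subspace_preimage _ _ (@subspace_set0 _ H)).
      exact: (subspace_preimage sD2 lS2 (@subspace_set0 _ H)).
    by apply: linear_onW lS => x [[]].
have lQ : linear_on setT (fun x => x - P x).
  by move=> c x y _ _; rewrite lP// opprD addrACA scalerBr.
have sKer : is_subspace (D `&` [set x | S x = 0]).
  exact: (subspace_preimage sD lS (@subspace_set0 _ H)).
apply: (@finite_dim_ker_image _ _ V _ (fun x => x - P x)) => //.
- exact: linear_onW lQ.
- by move=> _ [x _ <-]; have [] := orthoprojP fV x.
apply: finite_dimS fK.
  by apply: (subspace_preimage sKer _ (@subspace_set0 _ H)); exact: linear_onW lQ.
move=> x [[Dx Sx] /= xP].
have xE : x = P x by apply/eqP; rewrite -subr_eq0 xP.
have D2x : D2 x by split => //; rewrite xE; have [] := orthoprojP fV x.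
by split => //=; rewrite S2E// Sx (linear_on0 (@subspace_setT _ H) lP).
Qed.

(** Modulo the finite-dimensional spaces [V] and [S V], the range of [S] and the range
of its compression agree. *)
Lemma finite_codim_compression :
  finite_codim setT (S @` D) <-> finite_codim K (S2 @` D2).
Proof.
have S2K x : D2 x -> K (S2 x) by move=> Dx; rewrite S2E//; have [] := orthoprojP fV (S x).
split=> [[N fN NE]|[N fN NE]].
  exists (sumset (P @` (S @` V)) (P @` N)).
    by apply: finite_dim_sumset; apply: fP => //; exact: (finite_dim_image sD lS).
  apply/seteqP; split=> [y Ky|].
    have : sumset (S @` D) N y by rewrite -NE.
    move=> [_ [x + <-] [n Nn yE]]; rewrite DE => -[v Vv [d [Dd Kd] xE]].
    exists (S2 d); first by exists d.
    exists (P (S v) + P n).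
      exists (P (S v)); first by exists (S v) => //; exists v.
      by exists (P n) => //; exists n.
    rewrite S2E// addrA -(orthoproj_id fV Ky) -yE -/P.
    rewrite (linear_onD lP)// -xE (linear_onD lS)//; last exact: VD.
    by rewrite (linear_onD lP)// [P (S d) + _]addrC.
  move=> _ [_ [d Dd <-] [_ [_ [_ [v Vv <-] <-] [_ [n Nn <-] <-]] <-]].
  apply: (subspaceD sK); first exact: S2K.
  by apply: (subspaceD sK); [have [] := orthoprojP fV (S v)|have [] := orthoprojP fV n].
exists (sumset V N); first exact: finite_dim_sumset.
apply/seteqP; split=> // y _.
have [KPy VPy] := orthoprojP fV y.
have : sumset (S2 @` D2) N (P y) by rewrite -NE.
move=> [_ [d Dd <-] [n Nn PyE]].
have [_ VSd] := orthoprojP fV (S d).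
exists (S d); first by exists d => //; case: Dd.
exists ((y - P y - (S d - P (S d))) + n).
  by exists (y - P y - (S d - P (S d))); [exact: subspaceB|exists n].
rewrite opprB -(addrA (y - P y)) addrCA (addrA (S d)) (addrC (S d)) subrK.
by rewrite addrCA -S2E// PyE subrK.
Qed.

Lemma fredholm_compression :
  closed_on D S -> closed_on D2 S2 ->
  fredholm setT (Operator D S) <-> fredholm K (Operator D2 S2).
Proof.
move=> cS cS2; rewrite /fredholm /op_ker /op_range /=.
have cK : closed K by exact: orthocomp_closed.
have kerE (D' : set H) (f : H -> H) : [set x | D' x /\ f x = 0] = D' `&` [set x | f x = 0].
  by [].
rewrite !kerE; split=> -[cl fK _ fC].
  have /finite_codim_compression fC2 := fC.
  split; [exact/closed_opP|exact/finite_dim_ker_compression| |by []].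
  case: fC2 => N fN NE.
  exact: (closed_range_finite_codim sD2 lS2 cS2 cK fN NE).
have /finite_codim_compression fC1 := fC.
split; [exact/closed_opP|exact/finite_dim_ker_compression| |by []].
case: fC1 => N fN NE.
exact: (closed_range_finite_codim sD lS cS closedT fN NE).
Qed.

End Compression.
End OrthogonalProjection.

(** * Eigenvalues near Fredholm and resolvent points *)

Section ResolventAndBound.
Variables (R : realType) (H : completeNormedModType R[i]).

Lemma relative_bound_linear (a b : R) (x y z : H) : 0 <= a -> 0 <= b ->
  `|y| ^+ 2 <= (a ^+ 2)%:C * `|x| ^+ 2 + (b ^+ 2)%:C * `|z| ^+ 2 ->
  rnorm y <= a * rnorm x + b * rnorm z.
Proof.
move=> a0 b0; rewrite !rnormE !expr2 -!realcM -realcD lecR -!expr2 => le.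
have x0 := rnorm_ge0 x; have z0 := rnorm_ge0 z.
rewrite -(@ler_pXn2r _ 2)// ?nnegrE ?rnorm_ge0 ?addr_ge0 ?mulr_ge0//.
apply: le_trans le _; rewrite sqrrD !exprMn lerD2r lerDl.
by rewrite mulrn_wge0// !mulr_ge0.
Qed.

Lemma linear_on_shift (D : set H) (L : H -> H) (z : R[i]) :
  linear_on D L -> linear_on D (fun x => L x - z *: x).
Proof.
move=> lL k x y Dx Dy; rewrite lL// scalerDr scalerBr !scalerA [z * k]mulrC.
by rewrite opprD addrACA.
Qed.

Lemma eigenvalue_onB (D : set H) (L : H -> H) (c d : R[i]) :
  eigenvalue_on D (fun x => L x - c *: x) (d - c) <->
  exists x, [/\ D x, x != 0 & L x = d *: x].
Proof.
split=> -[x [Dx x0 Lx]]; exists x; split => //.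
  by move/eqP: Lx; rewrite scalerBl subr_eq subrK => /eqP.
by rewrite Lx scalerBl.
Qed.

(** The bound on the inverse excludes eigenvalues nearby, since an eigenvector [x] for
[d] satisfies [(L - c) x = (d - c) x]. *)
Lemma resolvent_near_punctured (L : operator H) (c : R[i]^o) :
  resolvent_set setT L c -> near_punctured (~` eigenvalues L) c.
Proof.
move=> [_ [M HM]]; exists (`|M| + 1)^-1; first by rewrite invr_gt0 ltr_wpDl.
move=> d /andP[_ dc] [x [Dx x0 Lx]].
have := HM x Dx; rewrite /op_shift/= Lx -scalerBl !rnormE -realcM lecR rnormZ.
have nx0 : 0 < rnorm x by rewrite rnorm_gt0.
rewrite mulrA ler_pMl// leNgt; apply/negP; rewrite negbK.
apply: (@le_lt_trans _ _ ((`|M| + 1) * rnorm (d - c))).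
  by apply: ler_wpM2r; [exact: rnorm_ge0|have := ler_norm M; lra].
by rewrite -ltr_pdivlMl ?mulr1// ltr_wpDl.
Qed.

Lemma fredholm_near_punctured (L : operator H) (c : R[i]^o) :
  linear_op L -> fredholm setT (op_shift L c) ->
  near_punctured (eigenvalues L) c \/ near_punctured (~` eigenvalues L) c.
Proof.
move=> [sD lL] [/closed_opP cS fK cR _].
have lS : linear_on (dom L) (op_shift L c) by exact: linear_on_shift.
have [r r0 [HE|HE]] := punctured_neighbourhood sD lS cS cR fK; [left|right].
  by exists r => // d /HE/eigenvalue_onB.
by exists r => // d /HE nE Ed; apply/nE/eigenvalue_onB.
Qed.

End ResolventAndBound.

(** * The essential spectrum and the eigenvalues of the perturbed operator *)

Theorem theorem2p2 (R : realType) (H : completeNormedModType R[i])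
    (dot : {dot H for conjC}) (T A : operator H) (a b : R) (Ht : set H)
    (H_hilbert : induces_norm dot)
    (T_normal : normal_op dot T)
    (A_linear : linear_op A)
    (dom_TA : dom T `<=` dom A)
    (a_ge0 : 0 <= a) (b_ge0 : 0 <= b) (b_lt1 : b < 1)
    (A_bounded : forall x, dom T x ->
       `|A x| ^+ 2 <= (a ^+ 2)%:C * `|x| ^+ 2 + (b ^+ 2)%:C * `|T x| ^+ 2)
    (Ht_subspace : is_subspace Ht)
    (Ht_dom : Ht `<=` dom T)
    (Ht_fin : finite_dim Ht) :
  let Hperp := orthocomp dot Ht in
  let D2 := dom T `&` Hperp in
  direct_sum (dom T) Ht D2 ->
  T @` Ht `<=` Ht ->
  T @` D2 `<=` Hperp ->
  let T2 := op_restrict T D2 in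
  let P2 := orthoproj dot Hperp in
  let A22 := Operator D2 (fun x => P2 (A x)) in
  let TA := op_add T A in
  [/\ forall x, D2 x ->
        `|A22 x| ^+ 2 <= (a ^+ 2)%:C * `|x| ^+ 2 + (b ^+ 2)%:C * `|T2 x| ^+ 2,
      ess_spectrum setT TA = ess_spectrum Hperp (op_add T2 A22) &
      forall Om : set R[i]^o,
        open Om -> connected Om ->
        Om `<=` ~` ess_spectrum setT TA ->
        Om `&` resolvent_set setT TA !=set0 ->
        countable (Om `&` eigenvalues TA) /\
        limit_point (Om `&` eigenvalues TA) `<=` boundary Om].
Proof.
move=> K D2 [DE _] _ TD2 T2 P2 A22 TA.
have [[sD lT] /closed_opP cT _ _] := T_normal.
have lTD : linear_on (dom T) T by [].
have lA : linear_on (dom T) A by move=> c x y /dom_TA Ax /dom_TA Ay; apply: A_linear.2.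
have lP : linear_on setT P2 by exact: orthoproj_linear.
have P2_id x : K x -> P2 x = x by exact: orthoproj_id.
have A22_bounded x : D2 x ->
    `|A22 x| ^+ 2 <= (a ^+ 2)%:C * `|x| ^+ 2 + (b ^+ 2)%:C * `|T2 x| ^+ 2.
  move=> [Dx _]; apply: le_trans (A_bounded x Dx).
  rewrite /= ler_pXn2r ?nnegrE// !rnormE lecR.
  exact: rnorm_orthoproj_le.
have lTA : linear_op TA.
  by split=> // c x y Dx Dy /=; rewrite lT// lA// scalerDr addrACA.
have D2T : D2 `<=` dom T by move=> x [].
have ess : ess_spectrum setT TA = ess_spectrum K (op_add T2 A22).
  have H_iff z : fredholm setT (op_shift TA z) <-> fredholm K (op_shift (op_add T2 A22) z).
    apply: (fredholm_compression H_hilbert Ht_fin Ht_dom sD DE) => //.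
    - exact: linear_on_shift lTA.2.
    - move=> x [Dx Kx] /=; rewrite -/P2 (linear_onB lP)// (linear_onD lP)//.
      rewrite (linear_onZ (@subspace_setT _ H) lP)//.
      by rewrite (P2_id (T x)) ?(P2_id x)//; apply: TD2; exists x.
    - apply: (closed_on_relatively_bounded (a := a) (b := b)) => // x Dx.
      by apply: relative_bound_linear => //; exact: A_bounded.
    - apply: (closed_on_relatively_bounded (a := a) (b := b)) => //.
      + by apply: subspaceI => //; exact: orthocomp_subspace.
      + exact: linear_onW lTD.
      + by move=> c x y /D2T Dx /D2T Dy /=; rewrite lA ?lP.
      + by apply: closed_onI => //; exact: orthocomp_closed.
      + by move=> x D2x; apply: relative_bound_linear => //; exact: A22_bounded.
  by apply/seteqP; split=> z nz /H_iff; exact: nz.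
split=> // Om oOm cOm Om_ess [c0 [Om_c0 res_c0]].
have dichotomy c : Om c -> near_punctured (eigenvalues TA) c \/
    near_punctured (~` eigenvalues TA) c.
  by move=> /Om_ess/contrapT; apply: fredholm_near_punctured.
have Om_E : Om `<=` near_punctured (~` eigenvalues TA).
  apply: connected_dichotomy => //.
  by exists c0; split => //; exact: resolvent_near_punctured.
by split; [exact: countable_near_punctured|exact: limit_point_near_punctured].
Qed.
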